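(* Let $K$ be a field and $1\le m\le n$. Let $\mathcal Z=\{([\lambda],\theta)\in\mathbb P^{m-1}(K)\times M_{m\times n}(K)\mid\lambda\theta=0\}$. The variety $\mathcal Z$ is the fine moduli space for the $\tilde{\mathsf Q}$-representations $W$ of dimension vector $\bigl(1,m-1,\binom{m-1}{2},\dots,1\bigr)$ that are generated by the last component $W_m$; that is, $\mathcal Z$ represents the functor $\tilde{\mathcal R}$ of such representations.
   Context: $\mathcal Z$ is the closed subscheme of $\mathbb P^{m-1}\times M_{m\times n}$ over $K$ defined by $\lambda\theta=0$, where $\lambda$ is a nonzero row vector of length $m$ with class $[\lambda]$. $\tilde{\mathsf Q}$ is the quiver with vertices $1,\dots,m$, arrows $g_1,\dots,g_n\colon a\to a+1$ and $\lambda_1,\dots,\lambda_m\colon a+1\to a$ for $1\le a\le m-1$, subject to the relations $\lambda_i\lambda_j+\lambda_j\lambda_i=0=\lambda_i^2$, $g_ig_j+g_jg_i=0=g_i^2$, $\lambda_k(\lambda_ig_j+g_j\lambda_i)=(\lambda_ig_j+g_j\lambda_i)\lambda_k$, $g_l(\lambda_ig_j+g_j\lambda_i)=(\lambda_ig_j+g_j\lambda_i)g_l$, read from every starting vertex, with paths composed right to left and terms passing through vertices outside $\{1,\dots,m\}$ dropped. Let $C$ be the resulting $K$-path algebra with relations. For a commutative $K$-algebra $A$, $\tilde{\mathcal R}(A)$ is the set of isomorphism classes of representations $W=(W_1,\dots,W_m)$ of $\tilde{\mathsf Q}$ (with these relations) in $A$-modules such that each $W_a$ is a projective $A$-module of rank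 $\binom{m-1}{a-1}$, $W_m=A$, and $W$ is generated by $W_m$ as a left $C$-module (over $A$). It is a functor of $A$ by base change, and ``$\mathcal Z$ represents $\tilde{\mathcal R}$'' means $\tilde{\mathcal R}(A)\cong\mathcal Z(A)$ naturally in $A$. *)

(* Defs.v *)
From HB Require Import structures.
From mathcomp Require Import all_boot all_algebra.
From mathcomp Require Import boolp classical_sets.

Set Implicit Arguments.
Unset Strict Implicit.
Unset Printing Implicit Defensive.

Import GRing.Theory.
Local Open Scope ring_scope.
Local Open Scope classical_set_scope.

(* [comAlgType K] excludes the zero algebra, hence this presentation of
   commutative K-algebras as commutative rings under K. *)
Record calg (K : fieldType) := CAlg {
  calg_ring :> comPzRingType;
  calg_str : {rmorphism K -> calg_ring} }.

Record calg_hom (K : fieldType) (A B : calg K) := CAlgHom {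
  calg_fun :> {rmorphism A -> B};
  calg_funE : forall c : K, calg_fun (calg_str A c) = calg_str B c }.

(* [iota] exhibits N as the base change of M along phi: it is the universal
   phi-semilinear map from M to a B-module, i.e. M -> B (x)_A M, x |-> 1 (x) x
   up to a unique isomorphism. *)
Definition is_base_change (A B : comPzRingType) (phi : {rmorphism A -> B})
    (M : lmodType A) (N : lmodType B) (iota : {linear M -> N | phi \; *:%R}) :=
  forall (P : lmodType B) (f : {linear M -> P | phi \; *:%R}),
    exists h : {linear N -> P}, (forall x, h (iota x) = f x) /\
      (forall h' : {linear N -> P}, (forall x, h' (iota x) = f x) -> h' =1 h).

Definition fg_projective (A : comPzRingType) (P : lmodType A) :=
  exists (k : nat) (s : {linear P -> 'rV[A]_k}) (p : {linear 'rV[A]_k -> P}),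
    cancel s p.

(* P is finitely generated projective and F (x)_A P is of dimension r at every
   field-valued point A -> F of Spec A (in particular at every residue
   field). *)
Definition projective_of_rank (A : comPzRingType) (r : nat) (P : lmodType A) :=
  fg_projective P /\
  forall (F : fieldType) (phi : {rmorphism A -> F}),
    exists iota : {linear P -> 'rV[F]_r | phi \; *:%R}, is_base_change iota.

(* An A-point of P^(m-1), with [lambda] the class of a row vector lambda: a
   direct summand of rank one L of the module of row vectors A^m.  For A a
   field, these are the lines spanned by the nonzero row vectors. *)
Definition proj_point (A : comPzRingType) (m : nat) (L : set 'rV[A]_m) :=
  exists (P : lmodType A) (i : {linear P -> 'rV[A]_m})
    (p : {linear 'rV[A]_m -> P}),
    [/\ cancel i p, range i = L & projective_of_rank 1 P].

(* The A-points of the closed subscheme lambda * theta = 0 of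
   P^(m-1) x M_(m x n). *)
Record Zpoint (m n : nat) (A : comPzRingType) := ZPoint {
  Zline : set 'rV[A]_m;
  Zmat : 'M[A]_(m, n);
  Zline_point : proj_point Zline;
  Zeq : forall lambda : 'rV[A]_m, Zline lambda -> lambda *m Zmat = 0 }.

Definition row_span (A : comPzRingType) (m : nat) (S : set 'rV[A]_m) :
    set 'rV[A]_m :=
  [set v | exists (k : nat) (c : 'I_k -> A) (s : 'I_k -> 'rV[A]_m),
    (forall i, S (s i)) /\ v = \sum_i c i *: s i].

(* z' is the image of z under Z(phi) : Z(A) -> Z(B).  As L is a direct summand
   of A^m, B (x)_A L is identified with the B-span of the image of L in B^m. *)
Definition Zpoint_base_change (m n : nat) (A B : comPzRingType)
    (phi : {rmorphism A -> B}) (z : Zpoint m n A) (z' : Zpoint m n B) :=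
  Zline z' = row_span (map_mx phi @` Zline z) /\ Zmat z' = map_mx phi (Zmat z).

(* Representations in A-modules of the quiver with vertices 1, ..., m, extended
   by zero to all a : nat: terms of the relations passing through a vertex
   outside {1, ..., m} then vanish.  The index a of an arrow is its lower
   vertex: rep_g j a : W_a -> W_(a+1) and rep_l i a : W_(a+1) -> W_a. *)
Record qrep (m n : nat) (A : comPzRingType) := QRep {
  rep_mod :> nat -> lmodType A;
  rep_g : 'I_n -> forall a, {linear rep_mod a -> rep_mod a.+1};
  rep_l : 'I_m -> forall a, {linear rep_mod a.+1 -> rep_mod a};
  rep_out : forall a, ~~ (0 < a <= m)%N -> forall x : rep_mod a, x = 0;
  rep_ll : forall i j a (x : rep_mod a.+2),
    rep_l i a (rep_l j a.+1 x) + rep_l j a (rep_l i a.+1 x) = 0;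
  rep_l2 : forall i a (x : rep_mod a.+2), rep_l i a (rep_l i a.+1 x) = 0;
  rep_gg : forall i j a (x : rep_mod a),
    rep_g i a.+1 (rep_g j a x) + rep_g j a.+1 (rep_g i a x) = 0;
  rep_g2 : forall i a (x : rep_mod a), rep_g i a.+1 (rep_g i a x) = 0;
  rep_lgl : forall k i j a (x : rep_mod a.+2),
    rep_l k a.+1 (rep_l i a.+2 (rep_g j a.+2 x) +
                  rep_g j a.+1 (rep_l i a.+1 x)) =
    rep_l i a.+1 (rep_g j a.+1 (rep_l k a.+1 x)) +
      rep_g j a (rep_l i a (rep_l k a.+1 x));
  rep_glg : forall l i j a (x : rep_mod a.+1),
    rep_g l a.+1 (rep_l i a.+1 (rep_g j a.+1 x) + rep_g j a (rep_l i a x)) =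
    rep_l i a.+2 (rep_g j a.+2 (rep_g l a.+1 x)) +
      rep_g j a.+1 (rep_l i a.+1 (rep_g l a.+1 x)) }.

(* The submodule generated by the component W_m under the path algebra. *)
Inductive gen_top (m n : nat) (A : comPzRingType) (W : qrep m n A) :
    forall a, W a -> Prop :=
| gen_in (x : W m) : gen_top x
| gen_lin a (c : A) (x y : W a) :
    gen_top x -> gen_top y -> gen_top (c *: x + y)
| gen_g j a (x : W a) : gen_top x -> gen_top (rep_g W j a x)
| gen_l i a (x : W a.+1) : gen_top x -> gen_top (rep_l W i a x).

(* W_m = A is imposed up to isomorphism, as representations are only
   considered up to isomorphism below. *)
Definition moduli_rep (m n : nat) (A : comPzRingType) (W : qrep m n A) :=
  [/\ forall a, (0 < a <= m)%N ->
        projective_of_rank 'C(m.-1, a.-1) (W a),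
      exists f : {linear W m -> A^o}, bijective f &
      forall a (x : W a), gen_top x].

Definition rep_iso (m n : nat) (A : comPzRingType) (W W' : qrep m n A) :=
  exists f : forall a, {linear W a -> W' a},
    [/\ forall a, bijective (f a),
        forall j a x, f a.+1 (rep_g W j a x) = rep_g W' j a (f a x) &
        forall i a x, f a (rep_l W i a x) = rep_l W' i a (f a.+1 x)].

Definition rep_base_change (m n : nat) (A B : comPzRingType)
    (phi : {rmorphism A -> B}) (W : qrep m n A) (W' : qrep m n B) :=
  exists f : forall a, {linear W a -> W' a | phi \; *:%R},
    [/\ forall a, is_base_change (f a),
        forall j a x, f a.+1 (rep_g W j a x) = rep_g W' j a (f a x) &
        forall i a x, f a (rep_l W i a x) = rep_l W' i a (f a.+1 x)].

Definition iso_class (m n : nat) (A : comPzRingType) (W : qrep m n A) :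
    qrep m n A -> Prop :=
  fun W' => moduli_rep W' /\ rep_iso W W'.

Definition Rtilde (m n : nat) (A : comPzRingType) :=
  {C : qrep m n A -> Prop | exists W, moduli_rep W /\ C = iso_class W}.

Definition Rtilde_base_change (m n : nat) (A B : comPzRingType)
    (phi : {rmorphism A -> B}) (x : Rtilde m n A) (y : Rtilde m n B) :=
  exists (W : qrep m n A) (W' : qrep m n B),
    [/\ sval x W, sval y W' & rep_base_change phi W W'].

(* Main.v *)
Require Import Defs.
From HB Require Import structures.
From mathcomp Require Import all_boot all_algebra.
From mathcomp Require Import boolp classical_sets.
From mathcomp Require Import ring_quotient.

(** A point ([lambda], theta) is a direct summand L of rank one of the row
    vectors A^(m+1) (the top vertex of the quiver is called m+1 throughout)
    together with a matrix theta killed by L.  Put Q = A^(m+1) / L, which is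
    projective of rank m.  The columns of theta are linear forms on A^(m+1)
    vanishing on L, hence linear forms on Q, and the representation attached to
    the point is the exterior algebra of Q, with Λ^d Q at the vertex m+1-d:
    lambda_i is the exterior product with the class of the i-th basis vector
    and g_j is the contraction with the j-th column of theta.  Both families
    anticommute, and lambda_i g_j + g_j lambda_i is the scalar theta_ij, which
    gives all the relations of the quiver.  It is generated by 1 in Λ^0 Q.

    Conversely, let W be generated by a basis w of W_(m+1) = A.  The point is
    read off from W: L consists of the v with sum_i v_i lambda_i = 0 on
    W_(m+1), and theta_ij is the scalar by which g_j lambda_i acts there
    ([classified]).  The anticommutators lambda_i g_j + g_j lambda_i commute
    with all arrows, so they act by theta_ij everywhere.  Therefore g can be
    pushed through the lambda's until it kills w, and W is spanned by the
    products of lambda's applied to w.  By the universal property of the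
    exterior algebra ([elift]) W is a quotient of ΛQ ([ext_eval_surj],
    [ext_eval_proj]).  In each degree this is a surjection between projective
    modules of the same rank, so it is an isomorphism ([ext_rep_iso]).

    As ranks are measured at field-valued points, one needs enough of them: a
    nonunit of A vanishes at some point with values in a field
    ([nonunit_field_point]).  An idempotent matrix M vanishing at all these
    points is zero, because det(1 - M) is then a unit ([idempotent_eq0]); this
    is what makes surjections between projective modules of equal rank
    injective ([surj_same_rank_inj]).

    Projective modules are handled as images of idempotent endomorphisms of
    free modules.  A complement of L is the row space of an idempotent matrix N
    with kernel L ([proj_pointP]), and ΛQ is the image of the endomorphism ΛN
    of the exterior algebra of A^(m+1) ([ext_mod]).  Over a field N factors
    through a space of dimension m, so that ΛN factors through the exterior
    algebra of F^m, whose graded pieces have binomial dimensions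
    ([ext_mod_rank]). *)

Set Implicit Arguments.
Unset Strict Implicit.
Unset Printing Implicit Defensive.

Import GRing.Theory.
Local Open Scope ring_scope.
Local Open Scope classical_set_scope.

(** * Field-valued points at which a nonunit vanishes *)

(** Such a set I contains 0 = (-1) x + x, so it is an ideal. *)
Definition proper_ideal_of (R : comNzRingType) (x : R) (I : set R) :=
  [/\ I x, forall a u v, I u -> I v -> I (a * u + v) & ~ I 1].

(** Maximality is recorded in the form needed for the quotient to be a field:
    an element outside I is invertible modulo I. *)
Lemma exists_maximal_ideal (R : comNzRingType) (x : R) :
  ~ (exists y, y * x = 1) ->
  exists I : set R, proper_ideal_of x I /\
    forall y, ~ I y -> exists a b, I b /\ a * y + b = 1.
Proof.
move=> nux.
(* The empty set is let in so that the union of the empty chain qualifies. *)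
pose P (I : set R) := I = set0 \/ proper_ideal_of x I.
have [F FP Ftot|I [PI Imax]] := @Zorn_bigcup R P.
  have [F0|] := pselect (forall I, F I -> I = set0).
    by left; apply/seteqP; split=> // y [I FI /=]; rewrite (F0 I FI).
  move=> /existsNP[I0] /not_implyP[FI0 I0n].
  have FQ J y : F J -> J y -> proper_ideal_of x J.
    by move=> FJ Jy; case: (FP J FJ) => // J0; rewrite J0 in Jy.
  have [I0x _ _] : proper_ideal_of x I0 by case: (FP _ FI0).
  right; split.
  - by exists I0.
  - move=> a u v [J1 FJ1 J1u] [J2 FJ2 J2v].
    case: (Ftot _ _ FJ1 FJ2) => sJ.
      by exists J2 => //; have [_ cl _] := FQ _ _ FJ2 J2v;
        apply: cl => //; apply: sJ.
    by exists J1 => //; have [_ cl _] := FQ _ _ FJ1 J1u;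
      apply: cl => //; apply: sJ.
  - by move=> [J FJ J1]; have [_ _] := FQ _ _ FJ J1.
have xP : proper_ideal_of x [set y | exists a, y = a * x].
  split.
  - by exists 1; rewrite mul1r.
  - by move=> a u v [b ->] [c ->]; exists (a * b + c); rewrite mulrDl mulrA.
  - by move=> [a a1]; apply: nux; exists a.
have IP : proper_ideal_of x I.
  case: PI => // I0; case: (Imax [set y | exists a, y = a * x]); last by right.
  rewrite I0; split=> // /(_ x); apply; by exists 1; rewrite mul1r.
have [Ix Ilin I1] := IP.
exists I; split=> // y nIy; apply: contrapT => nyI.
(* A noninvertible y outside I could be adjoined to I. *)
case: (Imax [set z | exists a b, I b /\ z = a * y + b]).
  split=> [z Iz /=|sub]; first by exists 0, z; rewrite mul0r add0r.
  apply: nIy; apply: sub; exists 1, 0; split; last by rewrite mul1r addr0.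
  by rewrite -[0](addNr x) -mulN1r; apply: Ilin.
right; split.
- by exists 0, x; rewrite mul0r add0r.
- move=> a u v [b [c [Ic ->]]] [d [e [Ie ->]]].
  exists (a * b + d), (a * c + e); split; first exact: Ilin.
  by rewrite mulrDr !mulrDl !mulrA addrACA.
- by move=> [a [b [Ib ab]]]; apply: nyI; exists a, b.
Qed.

Section FieldOfInverses.
Variables (R : comNzRingType) (hR : forall x : R, x != 0 -> exists y, y * x = 1).

Let inv (x : R) : R := if pselect (x != 0) is left h then sval (cid (hR h)) else 0.

Fact inv_mulVf x : x != 0 -> inv x * x = 1.
Proof. by move=> x0; rewrite /inv; case: pselect => // h; case: cid. Qed.

Fact inv0 : inv 0 = 0.
Proof. by rewrite /inv; case: pselect => // h; have := h; rewrite eqxx. Qed.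

Definition field_of_inverses : fieldType := HB.pack_for fieldType R
  (GRing.ComNzRing_isField.Build R inv_mulVf inv0).
End FieldOfInverses.

(** The field is the quotient by a maximal ideal containing x. *)
Lemma nz_nonunit_field_point (R : comNzRingType) (x : R) :
  ~ (exists y, y * x = 1) ->
  exists (F : fieldType) (phi : {rmorphism R -> F}), phi x = 0.
Proof.
move=> /exists_maximal_ideal[I [[Ix Ilin I1] Imax]].
pose Ib : R -> bool := fun y => `[< I y >].
have I0 : I 0 by rewrite -[0](addNr x) -mulN1r; apply: Ilin.
have Icl : idealr_closed Ib.
  split; first exact/asboolP.
  - by apply/asboolPn.
  - by move=> a u v /asboolP Iu /asboolP Iv; apply/asboolP/Ilin.
pose J : idealr R := HB.pack_for (idealr R) Ib (isIdealr.Build R Ib Icl).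
have piJ0 y : \pi_({ideal_quot J})%qT y = 0 <-> I y.
  rewrite -[in X in X <-> _](raddf0 (\pi_({ideal_quot J})%qT)).
  split=> [/eqP|Iy]; last apply/eqP.
    by rewrite -Quotient.idealrBE subr0 => /asboolP.
  by rewrite -Quotient.idealrBE subr0; apply/asboolP.
have hF (q : {ideal_quot J}) : q != 0 -> exists y, y * q = 1.
  elim/quotW: q => y /eqP/piJ0/Imax[a [b [Ib' ab]]].
  exists (\pi a)%qT; rewrite -rmorphM -(addrK b (a * y)) ab rmorphB rmorph1.
  by rewrite -[RHS]subr0; congr (_ - _); apply/piJ0.
exists (@field_of_inverses _ hF).
exists (\pi_({ideal_quot J})%qT : {rmorphism R -> {ideal_quot J}}).
exact/piJ0.
Qed.

(** In the zero ring every element is a unit, so the existence of a nonunit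
    makes A nontrivial. *)
Lemma nonunit_field_point (A : comPzRingType) (x : A) :
  ~ (exists y, y * x = 1) ->
  exists (F : fieldType) (phi : {rmorphism A -> F}), phi x = 0.
Proof.
move=> nux; have A1 : 1 != 0 :> A.
  by apply/eqP => A1; apply: nux; exists 0; rewrite mul0r A1.
pose R : comNzRingType := HB.pack_for comNzRingType A
  (GRing.PzSemiRing_isNonZero.Build A A1).
exact: (@nz_nonunit_field_point R x).
Qed.

(** * Base change and ranks of projective modules *)

Definition linear_of (A : comPzRingType) (M N : lmodType A) (f : M -> N)
    (hf : linear f) : {linear M -> N} :=
  HB.pack_for {linear M -> N} f (GRing.isLinear.Build A M N *:%R f hf).

Definition semilinear_of (A B : comPzRingType) (phi : {rmorphism A -> B})
    (M : lmodType A) (N : lmodType B) (f : M -> N)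
    (hf : forall a x y, f (a *: x + y) = phi a *: f x + f y) :
    {linear M -> N | phi \; *:%R} :=
  HB.pack_for {linear M -> N | phi \; *:%R} f
    (GRing.isLinear.Build A M N (phi \; *:%R) f hf).

(** At every point det (1 - M) takes the value det 1 = 1, so it is a unit of A;
    as M (1 - M) = 0, it follows that M = 0. *)
Lemma idempotent_eq0 (A : comPzRingType) k (M : 'M[A]_k) : M *m M = M ->
  (forall (F : fieldType) (phi : {rmorphism A -> F}), map_mx phi M = 0) -> M = 0.
Proof.
move=> MM M0; have [y y1] : exists y, y * \det (1%:M - M) = 1.
  apply: contrapT => /nonunit_field_point[F [phi]].
  rewrite -det_map_mx map_mxB map_mx1 M0 subr0 det1 => /eqP.
  by rewrite oner_eq0.
rewrite -[M]scale1r -y1 -scalerA -(mul_scalar_mx (\det _)) -mul_adj_mx -mulmxA.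
by rewrite mulmxBl mul1mx MM subrr mulmx0 scaler0.
Qed.

(** If E1 cuts out a summand of the image of E, then E - E1 is idempotent, and
    it vanishes at each point where E1 has the full rank of E. *)
Lemma idempotent_eq (A : comPzRingType) k (E E1 : 'M[A]_k) :
  E *m E = E -> E1 *m E1 = E1 -> E1 *m E = E1 -> E *m E1 = E1 ->
  (forall (F : fieldType) (phi : {rmorphism A -> F}),
     (\rank (map_mx phi E) <= \rank (map_mx phi E1))%N) -> E = E1.
Proof.
move=> EE E11 E1E EE1 rk; apply/eqP; rewrite -subr_eq0; apply/eqP.
apply: idempotent_eq0 => [|F phi].
  by rewrite mulmxBl !mulmxBr EE EE1 E1E E11 subrr subr0.
rewrite map_mxB; set D := map_mx phi E; set D1 := map_mx phi E1.
have sD : (D1 <= D)%MS by rewrite -[D1](_ : D1 *m D = _) ?submxMl // -map_mxM E1E.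
have /submxP[X DX] : (D <= D1)%MS.
  by rewrite -(geq_leqif (mxrank_leqif_sup sD)) rk.
have : D *m D1 = D1 by rewrite -map_mxM EE1.
by rewrite DX -mulmxA -map_mxM E11 => ->; rewrite subrr.
Qed.

(** For E = c r with c of full column rank and r of full row rank, the equation
    c r c r = c r can be cancelled on both sides. *)
Lemma row_col_base_idempotent (F : fieldType) k (E : 'M[F]_k) : E *m E = E ->
  row_base E *m col_base E = 1%:M.
Proof.
move=> EE; apply: (row_free_inj (row_base_free E)).
apply: (row_full_inj (col_base_full E)).
move: (row_base E) (col_base E) (mulmx_base E) => r c cr.
by rewrite mul1mx -mulmxA cr mulmxA cr EE.
Qed.

Section BaseChange.
Variables (A B : comPzRingType) (phi : {rmorphism A -> B}).

(** Base change passes to direct summands, provided that the base change of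
    the idempotent s p cuts out N in N'. *)
Lemma bc_summand (M M' : lmodType A) (N N' : lmodType B)
    (s : {linear M -> M'}) (p : {linear M' -> M})
    (s' : {linear N -> N'}) (p' : {linear N' -> N})
    (iota : {linear M' -> N' | phi \; *:%R}) :
  cancel s p -> cancel s' p' ->
  (forall x, s' (p' (iota x)) = iota (s (p x))) -> is_base_change iota ->
  exists iota' : {linear M -> N | phi \; *:%R}, is_base_change iota'.
Proof.
move=> sK sK' e bc.
have hf a x y : p' (iota (s (a *: x + y))) =
    phi a *: p' (iota (s x)) + p' (iota (s y)) by rewrite !linearP.
exists (semilinear_of hf) => P f.
have hg a x y : f (p (a *: x + y)) = phi a *: f (p x) + f (p y) by rewrite !linearP.
have [h [hE hU]] := bc P (semilinear_of hg).
exists (h \o s'); split=> [x|h1 h1E y] /=; first by rewrite e hE /= !sK.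
rewrite -[in LHS](sK' y) -(hU (h1 \o p')) // => x /=.
by rewrite -h1E /= -e sK'.
Qed.

Lemma bc_uniq (M : lmodType A) (N1 N2 : lmodType B)
    (i1 : {linear M -> N1 | phi \; *:%R}) (i2 : {linear M -> N2 | phi \; *:%R}) :
  is_base_change i1 -> is_base_change i2 ->
  exists (h : {linear N1 -> N2}) (g : {linear N2 -> N1}), cancel h g /\ cancel g h.
Proof.
move=> b1 b2; have [h [hE _]] := b1 _ i2; have [g [gE _]] := b2 _ i1.
exists h, g; split=> x.
  have [k [_ kU]] := b1 _ i1; apply: etrans (esym (kU idfun _ x)) => //.
  by apply: (kU (g \o h)) => y /=; rewrite hE gE.
have [k [_ kU]] := b2 _ i2; apply: etrans (esym (kU idfun _ x)) => //.
by apply: (kU (h \o g)) => y /=; rewrite gE hE.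
Qed.

Lemma map_mx_semilin m n a (x y : 'M[A]_(m, n)) :
  map_mx phi (a *: x + y) = phi a *: map_mx phi x + map_mx phi y.
Proof. by rewrite map_mxD map_mxZ. Qed.

Lemma bc_row k : is_base_change (semilinear_of (@map_mx_semilin 1 k)).
Proof.
move=> P f.
have hlin : linear (fun v : 'rV[B]_k => \sum_i v 0 i *: f (delta_mx 0 i)).
  move=> a u v; rewrite scaler_sumr -big_split /=; apply: eq_bigr => i _.
  by rewrite !mxE scalerDl scalerA.
exists (linear_of hlin); split=> [x|h' h'E v] /=.
  rewrite [in RHS](row_sum_delta x) linear_sum; apply: eq_bigr => i _.
  by rewrite linearZ mxE.
rewrite [in LHS](row_sum_delta v) linear_sum; apply: eq_bigr => i _.
by rewrite linearZ -h'E /= map_delta_mx.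
Qed.

End BaseChange.

(** The idempotent matrix presenting P as a summand of a free module. *)
Definition summand_mx (A : comPzRingType) (P : lmodType A) k
    (s : P -> 'rV[A]_k) (p : 'rV[A]_k -> P) : 'M[A]_k := lin1_mx (s \o p).

Section Rank.
Variables (A : comPzRingType) (P : lmodType A) (k : nat).
Variables (s : {linear P -> 'rV[A]_k}) (p : {linear 'rV[A]_k -> P}).
Hypothesis sK : cancel s p.

Lemma mul_summand_mx u : u *m summand_mx s p = s (p u).
Proof. exact: (mul_rV_lin1 (s \o p)). Qed.

Lemma summand_mx_idem : summand_mx s p *m summand_mx s p = summand_mx s p.
Proof. by apply/row_matrixP => i; rewrite !rowE mulmxA !mul_summand_mx sK. Qed.

(** Over a field the base change of P is the row space of the base change of
    its idempotent. *)
Lemma bc_rank (F : fieldType) (phi : {rmorphism A -> F}) :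
  exists iota : {linear P -> 'rV[F]_(\rank (map_mx phi (summand_mx s p)))
                 | phi \; *:%R}, is_base_change iota.
Proof.
set E := map_mx phi _.
have EE : E *m E = E by rewrite -map_mxM summand_mx_idem.
apply: (@bc_summand A F phi P _ _ _ s p (mulmxr (row_base E))
  (mulmxr (col_base E)) (semilinear_of (@map_mx_semilin _ _ phi 1 k)) sK).
- by move=> v /=; rewrite -mulmxA row_col_base_idempotent // mulmx1.
- by move=> x /=; rewrite -mulmxA mulmx_base -map_mxM mul_summand_mx.
- exact: bc_row.
Qed.

Lemma bc_rank_uniq (F : fieldType) (phi : {rmorphism A -> F}) r
    (iota : {linear P -> 'rV[F]_r | phi \; *:%R}) :
  is_base_change iota -> \rank (map_mx phi (summand_mx s p)) = r.
Proof.
move=> bc; have [iota' bc'] := bc_rank phi; move: iota' bc'.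
set q := \rank _; move=> iota' bc'.
have [h [g [hK gK]]] := bc_uniq bc' bc.
have le a b (u : {linear 'rV[F]_a -> 'rV[F]_b})
    (v : {linear 'rV[F]_b -> 'rV[F]_a}) :
    cancel u v -> (a <= b)%N.
  move=> uK; rewrite -[a](mxrank1 F) (_ : 1%:M = lin1_mx u *m lin1_mx v).
    by apply: leq_trans (mxrankM_maxl _ _) (rank_leq_col _).
  by apply/row_matrixP => i; rewrite !rowE mulmxA !mul_rV_lin1 uK mulmx1.
by apply/eqP; rewrite eqn_leq !(le _ _ _ _ hK, le _ _ _ _ gK).
Qed.

(** The rank of P can be computed from any presentation as a summand. *)
Lemma projective_of_rankP r : projective_of_rank r P <->
  forall (F : fieldType) (phi : {rmorphism A -> F}),
    \rank (map_mx phi (summand_mx s p)) = r.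
Proof.
split=> [[_ bc] F phi|rk].
  by have [iota /bc_rank_uniq] := bc F phi.
split=> [|F phi]; first by exists k, s, p.
by have := bc_rank phi; rewrite rk.
Qed.
End Rank.

Lemma linear_section (A : comPzRingType) (P Q : lmodType A) (h : {linear P -> Q}) :
  fg_projective Q -> (forall y, exists x, h x = y) ->
  exists t : {linear Q -> P}, cancel t h.
Proof.
move=> [k [s [p sK]]] /choice[g gK].
have hl : linear (fun y => \sum_i s y 0 i *: g (p (delta_mx 0 i))).
  move=> a u v; rewrite scaler_sumr -big_split /=; apply: eq_bigr => i _.
  by rewrite linearP !mxE scalerDl scalerA.
exists (linear_of hl) => y /=.
rewrite -[RHS]sK [in RHS](row_sum_delta (s y)) !linear_sum.
by apply: eq_bigr => i _; rewrite !linearZ gK.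
Qed.

(** The surjection splits because Q is projective.  Both P and Q are then
    summands of one free module, with idempotents E and E1 such that
    E E1 = E1 E = E1, and these agree by comparison of ranks. *)
Lemma surj_same_rank_inj (A : comPzRingType) (P Q : lmodType A) r
    (h : {linear P -> Q}) :
  projective_of_rank r P -> projective_of_rank r Q ->
  (forall y, exists x, h x = y) -> bijective h.
Proof.
move=> prP prQ h_surj.
have [t tK] := linear_section prQ.1 h_surj.
have [[k [s [p sK]]] _] := prP.
have rP := (projective_of_rankP sK r).1 prP.
have stK : cancel (s \o t) (h \o p) by move=> y /=; rewrite sK tK.
have rQ := (projective_of_rankP stK r).1 prQ.
set E := summand_mx s p in rP; set E1 := summand_mx (s \o t) (h \o p) in rQ.
have mE u : u *m E = s (p u) := mul_summand_mx s p u.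
have mE1 u : u *m E1 = s (t (h (p u))) := mul_summand_mx (s \o t) (h \o p) u.
have EE1 : E = E1.
  apply: idempotent_eq; try by apply/row_matrixP => i;
    rewrite !rowE mulmxA ?mE ?mE1 ?sK ?tK // mE1 sK tK.
  by move=> F phi; rewrite rP rQ.
exists t => // x; apply: (can_inj sK).
by have := mE (s x); rewrite EE1 mE1 sK.
Qed.

Lemma rank0_eq0 (A : comPzRingType) (P : lmodType A) :
  projective_of_rank 0 P -> forall x : P, x = 0.
Proof.
move=> pr0 x; have [[k [s [p sK]]] _] := pr0.
have rP := (projective_of_rankP sK 0).1 pr0.
have M0 : summand_mx s p = 0.
  apply: idempotent_eq0 => [|F phi]; first exact: summand_mx_idem.
  by apply/eqP; rewrite -mxrank_eq0 rP.
apply: (can_inj sK); rewrite linear0.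
by have := mul_summand_mx s p (s x); rewrite M0 mulmx0 sK.
Qed.

(** * The exterior algebra of a free module *)

Section Exterior.
Variable A : comPzRingType.

(** The exterior algebra of A^k.  Splitting off the first basis vector e of
    A^(k+1) writes an element as x + e /\ y with x, y in the exterior algebra
    of the span of the other ones, which is the pair (x, y).  With this
    encoding all identities below go by induction on k, without signs of
    permutations. *)
Fixpoint ext k : lmodType A :=
  if k is k'.+1 then GRing.Lmodule.clone A (ext k' * ext k')%type _
  else GRing.Lmodule.clone A A^o _.

Definition ext_pair k (x y : ext k) : ext k.+1 := (x, y).

Lemma extP k (P : ext k.+1 -> Prop) :
  (forall x y : ext k, P (ext_pair x y)) -> forall x, P x.
Proof. by move=> h [x y]; apply: h. Qed.

Lemma ext_pairK1 k (x y : ext k) : (ext_pair x y).1 = x. Proof. by []. Qed.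

Lemma ext_pairK2 k (x y : ext k) : (ext_pair x y).2 = y. Proof. by []. Qed.

Lemma ext_pairD k (x y x' y' : ext k) :
  ext_pair x y + ext_pair x' y' = ext_pair (x + x') (y + y').
Proof. by []. Qed.

Lemma ext_pairZ k a (x y : ext k) : a *: ext_pair x y = ext_pair (a *: x) (a *: y).
Proof. by []. Qed.

Lemma ext_pair0 k : ext_pair (0 : ext k) 0 = 0.
Proof. by []. Qed.

(** The unit of the exterior algebra. *)
Fixpoint vac k : ext k :=
  if k is k'.+1 return ext k then ext_pair (vac k') 0 else 1.

(** Left multiplication by the vector v = v_0 e + v': it sends x + e /\ y to
    v' /\ x + e /\ (v_0 x - v' /\ y). *)
Fixpoint wedge k : 'rV[A]_k -> ext k -> ext k :=
  if k is k'.+1 return 'rV[A]_k -> ext k -> ext k then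
    fun v x => ext_pair (wedge (col' ord0 v) x.1)
                        (v 0 ord0 *: x.1 - wedge (col' ord0 v) x.2)
  else fun _ _ => 0.

(** Contraction with the linear form f = (f_0, f'): it sends x + e /\ y to
    f_0 y + i_f' x - e /\ i_f' y. *)
Fixpoint contract k : 'cV[A]_k -> ext k -> ext k :=
  if k is k'.+1 return 'cV[A]_k -> ext k -> ext k then
    fun f x => ext_pair (f ord0 0 *: x.2 + contract (row' ord0 f) x.1)
                        (- contract (row' ord0 f) x.2)
  else fun _ _ => 0.

Arguments ext_pair : simpl never.
Arguments ext : simpl never.
Arguments vac : simpl never.
Arguments wedge : simpl never.
Arguments contract : simpl never.

Lemma wedge_pair k (v : 'rV[A]_k.+1) (x y : ext k) : wedge v (ext_pair x y) =
  ext_pair (wedge (col' ord0 v) x) (v 0 ord0 *: x - wedge (col' ord0 v) y).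
Proof. by []. Qed.

Lemma contract_pair k (f : 'cV[A]_k.+1) (x y : ext k) : contract f (ext_pair x y) =
  ext_pair (f ord0 0 *: y + contract (row' ord0 f) x) (- contract (row' ord0 f) y).
Proof. by []. Qed.

Lemma vacS k : vac k.+1 = ext_pair (vac k) 0. Proof. by []. Qed.

Lemma wedge_is_linear k (v : 'rV[A]_k) : linear (wedge v).
Proof.
elim: k => [|k IH] in v * => a.
  by move=> x y; rewrite /wedge scaler0 addr0.
elim/extP => x1 x2; elim/extP => y1 y2.
rewrite !(wedge_pair, ext_pairD, ext_pairZ) !IH scalerBr opprD scalerDr !scalerA.
by rewrite mulrC addrACA.
Qed.
HB.instance Definition _ k v := GRing.isLinear.Build A (ext k) (ext k) *:%R
  (@wedge k v) (wedge_is_linear v).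

Lemma contract_is_linear k (f : 'cV[A]_k) : linear (contract f).
Proof.
elim: k => [|k IH] in f * => a.
  by move=> x y; rewrite /contract scaler0 addr0.
elim/extP => x1 x2; elim/extP => y1 y2.
rewrite !(contract_pair, ext_pairD, ext_pairZ) !IH !scalerDr opprD scalerN !scalerA.
by rewrite mulrC addrACA.
Qed.
HB.instance Definition _ k f := GRing.isLinear.Build A (ext k) (ext k) *:%R
  (@contract k f) (contract_is_linear f).

Lemma wedge_linearl k a (u v : 'rV[A]_k) x :
  wedge (a *: u + v) x = a *: wedge u x + wedge v x.
Proof.
elim: k => [|k IH] in u v x *; first by rewrite /wedge scaler0 addr0.
have cl : col' ord0 (a *: u + v) = a *: col' ord0 u + col' ord0 v.
  by apply/matrixP => i j; rewrite !mxE.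
elim/extP: x => x y; rewrite !wedge_pair ext_pairZ ext_pairD cl !IH !mxE.
by rewrite scalerBr opprD scalerDl scalerA addrACA.
Qed.

Lemma wedge0l k x : wedge (0 : 'rV[A]_k) x = 0.
Proof. by rewrite -[0](addNr 0) -scaleN1r wedge_linearl scaleN1r addNr. Qed.

Lemma wedgeDl k (u v : 'rV[A]_k) x : wedge (u + v) x = wedge u x + wedge v x.
Proof. by rewrite -[u in LHS]scale1r wedge_linearl scale1r. Qed.

Lemma wedgeZl k a (v : 'rV[A]_k) x : wedge (a *: v) x = a *: wedge v x.
Proof. by rewrite -[a *: v in LHS]addr0 wedge_linearl wedge0l addr0. Qed.

Lemma wedge_suml k I (r : seq I) (v : I -> 'rV[A]_k) x :
  wedge (\sum_(i <- r) v i) x = \sum_(i <- r) wedge (v i) x.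
Proof.
apply: (big_morph (fun v => wedge v x)); last exact: wedge0l.
by move=> u w; apply: wedgeDl.
Qed.

Lemma wedge_sq k (u : 'rV[A]_k) x : wedge u (wedge u x) = 0.
Proof.
elim: k => [|k IH] in u x *; first exact: erefl.
elim/extP: x => x y; rewrite !wedge_pair IH linearB linearZ /= IH.
by rewrite subr0 subrr ext_pair0.
Qed.

Lemma wedge_anti k (u v : 'rV[A]_k) x :
  wedge u (wedge v x) + wedge v (wedge u x) = 0.
Proof.
have := wedge_sq (u + v) x; rewrite wedgeDl !(wedgeDl, linearD) /= !wedge_sq.
by rewrite add0r addr0.
Qed.

Lemma contract_sq k (f : 'cV[A]_k) x : contract f (contract f x) = 0.
Proof.
elim: k => [|k IH] in f x *; first exact: erefl.
elim/extP: x => x y; rewrite !contract_pair !(linearD, linearN, linearZ) /= !IH.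
by rewrite scalerN addr0 addNr !oppr0 ext_pair0.
Qed.

Lemma contractDl k (f g : 'cV[A]_k) x :
  contract (f + g) x = contract f x + contract g x.
Proof.
elim: k => [|k IH] in f g x *; first by rewrite /contract addr0.
have cl : row' ord0 (f + g) = row' ord0 f + row' ord0 g.
  by apply/matrixP => i j; rewrite !mxE.
elim/extP: x => x y; rewrite !contract_pair ext_pairD cl !IH !mxE.
by rewrite scalerDl opprD addrACA.
Qed.

Lemma contract_anti k (f g : 'cV[A]_k) x :
  contract f (contract g x) + contract g (contract f x) = 0.
Proof.
have := contract_sq (f + g) x.
rewrite contractDl !(contractDl, linearD) /= !contract_sq.
by rewrite add0r addr0.
Qed.

(** The Clifford relation: the anticommutator of a product by v and of a
    contraction by f is the scalar f(v). *)
Lemma contract_wedge k (f : 'cV[A]_k) (v : 'rV[A]_k) x :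
  contract f (wedge v x) + wedge v (contract f x) = (v *m f) 0 0 *: x.
Proof.
elim: k => [|k IH] in f v x *.
  by rewrite /contract /wedge addr0 mxE big_ord0 scale0r.
have vf : (v *m f) 0 0 = v 0 ord0 * f ord0 0 + (col' ord0 v *m row' ord0 f) 0 0.
  rewrite !mxE big_ord_recl; congr (_ + _); apply: eq_bigr => i _.
  by rewrite !mxE.
elim/extP: x => x y; rewrite !(contract_pair, wedge_pair) ext_pairZ vf ext_pairD.
rewrite !scalerDl -!IH !(linearB, linearD, linearN, linearZ) /=; congr ext_pair.
  by rewrite scalerA scalerN -!addrA; congr (_ + _); rewrite addrCA addKr.
by rewrite !scalerN !opprK scalerA mulrC addrACA [_ *: y + _]addrC addKr.
Qed.

Lemma contract_vac k (f : 'cV[A]_k) : contract f (vac k) = 0.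
Proof.
elim: k => [|k IH] in f *; first exact: erefl.
by rewrite vacS contract_pair IH !linear0 addr0 ext_pair0.
Qed.

(** The exterior algebra is spanned by products of vectors.  Linear maps
    defined on it are compared through this principle. *)
Lemma ext_ind k (P : ext k -> Prop) :
  P (vac k) -> (forall a x y, P x -> P y -> P (a *: x + y)) ->
  (forall v x, P x -> P (wedge v x)) -> forall x, P x.
Proof.
elim: k => [|k IH] in P *.
  move=> P1 Plin _ x.
  have P0 : P 0 by rewrite -[0](addNr (vac 0)) -scaleN1r; apply: Plin.
  by have := Plin x _ _ P1 P0; rewrite addr0 [_ *: _](mulr1 (x : A)).
move=> P1 Plin Pw.
have [v0 [v00 v0']] : exists v : 'rV[A]_k.+1, v 0 ord0 = 1 /\ col' ord0 v = 0.
  exists (delta_mx 0 ord0); split; first by rewrite mxE !eqxx.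
  by apply/matrixP => i j; rewrite !mxE andbC.
have Px0 : forall x, P (ext_pair x 0).
  apply: IH => [//|a x y Px Py|v x Px].
    have := Plin a _ _ Px Py; by rewrite ext_pairZ ext_pairD scaler0 addr0.
  have := Pw (\row_j oapp (v 0) 0 (unlift ord0 j)) _ Px.
  rewrite wedge_pair mxE unlift_none /= scale0r linear0 subr0.
  by congr (P (ext_pair (wedge _ _) _)); apply/matrixP => i j;
    rewrite !mxE liftK ord1.
elim/extP => x y.
have := Plin 1 _ _ (Px0 x) (Pw v0 _ (Px0 y)).
by rewrite wedge_pair v0' v00 !wedge0l subr0 !scale1r ext_pairD addr0 add0r.
Qed.
End Exterior.
Arguments ext_pair : simpl never.
Arguments ext : simpl never.
Arguments vac : simpl never.
Arguments wedge : simpl never.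
Arguments contract : simpl never.

(** * Universal property and functoriality of the exterior algebra *)

(** Graded modules are indexed by the vertices of the quiver, so that an
    exterior product lowers the index. *)
Section Lift.
Variables (A : comPzRingType) (V : nat -> lmodType A).

Definition anticommuting k (e : 'I_k -> forall a, {linear V a.+1 -> V a}) :=
  (forall i a x, e i a (e i a.+1 x) = 0) /\
  (forall i j a x, e i a (e j a.+1 x) + e j a (e i a.+1 x) = 0).

Variable w : forall a, V a.

(** The universal property: anticommuting operators e_i of square zero on V
    extend to an action of the exterior algebra, and elift evaluates it on the
    vectors w, one component V_a at a time.  On x + e /\ y it is the value at x
    plus e_0 applied to the value at y, taken one vertex higher. *)
Fixpoint elift k : ('I_k -> forall a, {linear V a.+1 -> V a}) ->
    forall a, ext A k -> V a :=
  if k is k'.+1 return ('I_k -> forall a, {linear V a.+1 -> V a}) ->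
    forall a, ext A k -> V a then
    fun e a x => elift (fun i => e (lift ord0 i)) a x.1 +
                 e ord0 a (elift (fun i => e (lift ord0 i)) a.+1 x.2)
  else fun _ a x => (x : A) *: w a.

Arguments elift : simpl never.

Lemma elift_pair k (e : 'I_k.+1 -> forall a, {linear V a.+1 -> V a}) a x y :
  elift e a (ext_pair x y) = elift (fun i => e (lift ord0 i)) a x +
    e ord0 a (elift (fun i => e (lift ord0 i)) a.+1 y).
Proof. by []. Qed.

Lemma elift_is_linear k (e : 'I_k -> forall a, {linear V a.+1 -> V a}) a :
  linear (elift e a).
Proof.
elim: k => [|k IH] in e a * => c.
  by move=> x y; rewrite /elift scalerDl scalerA.
elim/extP => x1 x2; elim/extP => y1 y2.
rewrite ext_pairZ ext_pairD !elift_pair !IH linearD linearZ scalerDr.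
by rewrite addrACA.
Qed.
HB.instance Definition _ k e a := GRing.isLinear.Build A (ext A k) (V a) *:%R
  (@elift k e a) (elift_is_linear e a).

Lemma elift_vac k (e : 'I_k -> forall a, {linear V a.+1 -> V a}) a :
  elift e a (vac A k) = w a.
Proof.
elim: k => [|k IH] in e a *; first by rewrite /elift scale1r.
by rewrite vacS elift_pair IH !linear0 addr0.
Qed.

Lemma elift_wedge k (e : 'I_k -> forall a, {linear V a.+1 -> V a}) a v x :
  anticommuting e ->
  elift e a (wedge v x) = \sum_i v 0 i *: e i a (elift e a.+1 x).
Proof.
elim: k => [|k IH] in e a v x *.
  by move=> _; rewrite /wedge linear0 big_ord0.
move=> [sq anti]; have ih b y := IH (fun i => e (lift ord0 i)) b (col' ord0 v) y
  (conj (fun i => sq _) (fun i j => anti _ _)).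
elim/extP: x => x y; rewrite wedge_pair !elift_pair linearB linearZ /= !ih.
rewrite big_ord_recl linearB linearZ linearD /= sq addr0 addrCA; congr (_ + _).
rewrite linear_sum -sumrB; apply: eq_bigr => i _; rewrite mxE linearZ linearD /=.
rewrite -scalerBr; congr (_ *: (_ + _)); apply/eqP.
by rewrite -subr_eq0 -opprD oppr_eq0 anti.
Qed.

End Lift.
Arguments elift : simpl never.

Section ExtMx.
Variable A : comPzRingType.

Definition wedge_rows k l (M : 'M[A]_(k, l)) (i : 'I_k) (a : nat) :
  {linear ext A l -> ext A l} := wedge (row i M).

Lemma wedge_rows_anti k l (M : 'M[A]_(k, l)) :
  anticommuting (V := fun _ => ext A l) (wedge_rows M).
Proof. by split=> *; [apply: wedge_sq | apply: wedge_anti]. Qed.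

(** The map induced on exterior algebras by the matrix M, twisted by weights:
    since each exterior product shifts a by one, it is w (a + d) times
    the d-th exterior power of M on the part of degree d.  Constant weights 1
    give the exterior algebra functor; weights supported at one vertex b select
    the part of degree b - a. *)
Definition extmx k l (w : nat -> A) (M : 'M[A]_(k, l)) (a : nat) :
    ext A k -> ext A l :=
  elift (V := fun _ => ext A l) (fun b => w b *: vac A l) (wedge_rows M) a.

Lemma extmx_is_linear k l w (M : 'M[A]_(k, l)) a : linear (extmx w M a).
Proof. exact: (@elift_is_linear A (fun _ => ext A l) _ k _ a). Qed.
HB.instance Definition _ k l w M a := GRing.isLinear.Build A (ext A k) (ext A l)
  *:%R (@extmx k l w M a) (extmx_is_linear w M a).

Lemma extmx_vac k l w (M : 'M[A]_(k, l)) a : extmx w M a (vac A k) = w a *: vac A l.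
Proof. exact: (@elift_vac A (fun _ => ext A l)). Qed.

Lemma extmx_wedge k l w (M : 'M[A]_(k, l)) a v x :
  extmx w M a (wedge v x) = wedge (v *m M) (extmx w M a.+1 x).
Proof.
rewrite /extmx (@elift_wedge A (fun _ => ext A l)); last exact: wedge_rows_anti.
rewrite mulmx_sum_row wedge_suml; apply: eq_bigr => i _.
by rewrite wedgeZl.
Qed.

Lemma extmx_comp k l p w w' (M : 'M[A]_(k, l)) (M' : 'M[A]_(l, p)) a x :
  extmx w' M' a (extmx w M a x) = extmx (fun b => w b * w' b) (M *m M') a x.
Proof.
elim/ext_ind: x => [|c x y IHx IHy|v x IHx] in a *.
- by rewrite !extmx_vac linearZ /= extmx_vac scalerA.
- by rewrite !linearP /= IHx IHy.
- by rewrite !extmx_wedge IHx mulmxA.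
Qed.

Lemma extmx1 k a x : extmx (fun _ => 1) (1%:M : 'M[A]_k) a x = x.
Proof.
elim/ext_ind: x => [|c x y IHx IHy|v x IHx] in a *.
- by rewrite extmx_vac scale1r.
- by rewrite !linearP /= IHx IHy.
- by rewrite extmx_wedge IHx mulmx1.
Qed.

Lemma extmx_ext k l w w' (M : 'M[A]_(k, l)) a x : w =1 w' ->
  extmx w M a x = extmx w' M a x.
Proof. by move=> /funext ->. Qed.

(** Naturality of contractions: the form f on the target pulls back to the
    form M f.  A contraction lowers the degree, hence raises a. *)
Lemma contract_extmx k l w (M : 'M[A]_(k, l)) (f : 'cV[A]_l) a x :
  contract f (extmx w M a x) = extmx w M a.+1 (contract (M *m f) x).
Proof.
have cw p (g : 'cV[A]_p) (v : 'rV[A]_p) y :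
    contract g (wedge v y) = (v *m g) 0 0 *: y - wedge v (contract g y).
  by rewrite -contract_wedge addrK.
elim/ext_ind: x => [|c x y IHx IHy|v x IHx] in a *.
- by rewrite extmx_vac linearZ /= !contract_vac scaler0 linear0.
- by rewrite !linearP /= IHx IHy.
- by rewrite extmx_wedge !cw linearB linearZ /= extmx_wedge IHx mulmxA.
Qed.

End ExtMx.

Section ExtMap.
Variables (A B : comPzRingType) (phi : {rmorphism A -> B}).

Fixpoint ext_map k : ext A k -> ext B k :=
  if k is k'.+1 return ext A k -> ext B k then
    fun x => ext_pair (ext_map x.1) (ext_map x.2)
  else phi.
Arguments ext_map : simpl never.

Lemma ext_map_pair k (x y : ext A k) :
  ext_map (ext_pair x y) = ext_pair (ext_map x) (ext_map y).
Proof. by []. Qed.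

Lemma ext_map_semilin k a (x y : ext A k) :
  ext_map (a *: x + y) = phi a *: ext_map x + ext_map y.
Proof.
elim: k => [|k IH] in x y *.
  exact: (etrans (rmorphD phi _ _) (congr1 (+%R^~ _) (rmorphM phi _ _))).
elim/extP: x => x1 x2; elim/extP: y => y1 y2.
by rewrite ext_pairZ ext_pairD !ext_map_pair !IH ext_pairZ ext_pairD.
Qed.
HB.instance Definition _ k := GRing.isLinear.Build A (ext A k) (ext B k)
  (phi \; *:%R) (@ext_map k) (@ext_map_semilin k).

Lemma ext_map_vac k : ext_map (vac A k) = vac B k.
Proof.
elim: k => [|k IH]; first by rewrite /ext_map /vac rmorph1.
by rewrite !vacS ext_map_pair IH linear0.
Qed.

Lemma ext_map_wedge k (v : 'rV[A]_k) x :
  ext_map (wedge v x) = wedge (map_mx phi v) (ext_map x).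
Proof.
elim: k => [|k IH] in v x *; first by rewrite /wedge linear0.
elim/extP: x => x y.
rewrite wedge_pair !ext_map_pair wedge_pair linearB linearZ /= !IH.
have -> : map_mx phi (col' ord0 v) = col' ord0 (map_mx phi v) by rewrite map_col'.
by rewrite mxE.
Qed.

Lemma ext_map_extmx k l w (M : 'M[A]_(k, l)) a x :
  ext_map (extmx w M a x) = extmx (phi \o w) (map_mx phi M) a (ext_map x).
Proof.
elim/ext_ind: x => [|c x y IHx IHy|v x IHx] in a *.
- by rewrite extmx_vac linearZ /= !ext_map_vac extmx_vac.
- by rewrite !linearP /= IHx IHy.
- by rewrite !(extmx_wedge, ext_map_wedge) IHx map_mxM.
Qed.

(** Base change commutes with finite products, and the exterior algebra is an
    iterated product of copies of A. *)
Lemma bc_ext k : is_base_change (@ext_map k : {linear _ -> _ | phi \; *:%R}).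
Proof.
elim: k => [|k IH] P f.
  have hl : linear (fun b : ext B 0 => (b : B) *: f (vac A 0)).
    by move=> a x y; rewrite scalerDl scalerA.
  exists (linear_of hl); split=> [x|h hE y] /=.
    rewrite -[RHS](congr1 f (_ : x *: vac A 0 = x)) ?linearZ //.
    exact: (mulr1 (x : A)).
  rewrite -(hE (vac A 0)) /= ext_map_vac -linearZ /=; congr (h _).
  exact/esym/(mulr1 (y : B)).
have f1l a x y : f (ext_pair (a *: x + y) 0) =
    phi a *: f (ext_pair x 0) + f (ext_pair y 0).
  by rewrite -linearP ext_pairZ ext_pairD scaler0 addr0.
have f2l a x y : f (ext_pair 0 (a *: x + y)) =
    phi a *: f (ext_pair 0 x) + f (ext_pair 0 y).
  by rewrite -linearP ext_pairZ ext_pairD scaler0 addr0.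
have [h1 [h1E h1U]] := IH P (semilinear_of f1l).
have [h2 [h2E h2U]] := IH P (semilinear_of f2l).
have hl : linear (fun z : ext B k.+1 => h1 z.1 + h2 z.2).
  by move=> a x y; rewrite scalerDr addrACA -!linearP.
exists (linear_of hl); split=> [|h hE].
  elim/extP => x y; change (h1 (ext_map x) + h2 (ext_map y) = f (ext_pair x y)).
  rewrite h1E h2E /= -linearD ext_pairD.
  by rewrite addr0 add0r.
elim/extP => x y /=.
have l1 : linear (fun x => h (ext_pair x 0)).
  by move=> a u v; rewrite -linearP ext_pairZ ext_pairD scaler0 addr0.
have l2 : linear (fun x => h (ext_pair 0 x)).
  by move=> a u v; rewrite -linearP ext_pairZ ext_pairD scaler0 addr0.
rewrite -(h1U (linear_of l1)) => [|z]; last first.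
  by rewrite /= -hE /= ext_map_pair linear0.
rewrite -(h2U (linear_of l2)) => [|z]; last first.
  by rewrite /= -hE /= ext_map_pair linear0.
by rewrite /= -linearD ext_pairD addr0 add0r.
Qed.
End ExtMap.
Arguments ext_map : simpl never.

(** * Graded pieces of the exterior algebra *)

(** The rank of the sum of the graded pieces of degree d with P (a + d):
    Pascal's rule reflects the decomposition x + e /\ y. *)
Fixpoint grade_rank (P : pred nat) k a : nat :=
  if k is k'.+1 then (grade_rank P k' a + grade_rank P k' a.+1)%N else P a.

Lemma grade_rank_pred1 M k a :
  grade_rank (pred1 M) k a = if (a <= M)%N then 'C(k, M - a) else 0%N.
Proof.
elim: k => [|k IH] in a *.
  by rewrite /= bin0n subn_eq0; case: ltngtP.
rewrite /= !IH; case: ltngtP => [aM|//|->]; last by rewrite subnn !bin0.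
by rewrite -[(M - a)%N]prednK ?subn_gt0 // binS subnS.
Qed.

Section Grading.
Variable A : comPzRingType.

Definition indic (P : pred nat) (b : nat) : A := (P b)%:R.

(** The projection onto the graded pieces of degree d with P (a + d). *)
Definition grade_proj P k a : ext A k -> ext A k := extmx (indic P) 1%:M a.
HB.instance Definition _ P k a := GRing.Linear.on (@grade_proj P k a).

Lemma grade_proj_pair P k a (x y : ext A k) :
  grade_proj P a (ext_pair x y) = ext_pair (grade_proj P a x) (grade_proj P a.+1 y).
Proof.
suff claim (z : ext A k.+1) : grade_proj P a z =
    ext_pair (grade_proj P a z.1) (grade_proj P a.+1 z.2).
  exact: claim.
elim/ext_ind: z => [|c {}x {}y IHx IHy|v {}x IHx] in a *.
- rewrite /grade_proj extmx_vac vacS ext_pairK1 ext_pairK2 extmx_vac.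
  by rewrite linear0 ext_pairZ scaler0.
- by rewrite [LHS]linearP /= IHx IHy /grade_proj !linearP.
- rewrite /grade_proj in IHx *; rewrite extmx_wedge mulmx1 IHx.
  case: x {IHx} => {}x {}y; rewrite -[(x, y)]/(ext_pair x y) !wedge_pair.
  by rewrite !ext_pairK1 !ext_pairK2 !linearB linearZ /= !extmx_wedge !mulmx1.
Qed.

(** The sum of the selected graded pieces is free of rank [grade_rank].  For
    P = predT this says that the exterior algebra is free. *)
Lemma grade_proj_factor P k a : exists r (s : {linear 'rV[A]_r -> ext A k})
    (p : {linear ext A k -> 'rV[A]_r}),
  [/\ r = grade_rank P k a, cancel s p & forall x, s (p x) = grade_proj P a x].
Proof.
elim: k => [|k IH] in a *.
  have sl : linear (fun v : 'rV[A]_(P a) => \sum_i v 0 i *: vac A 0).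
    move=> c u v; rewrite scaler_sumr -big_split; apply: eq_bigr => i _ /=.
    by rewrite !mxE scalerDl scalerA.
  have pl : linear (fun x : ext A 0 => const_mx (x : A) : 'rV[A]_(P a)).
    by move=> c x y; apply/matrixP => i j; rewrite !mxE.
  exists (P a), (linear_of sl), (linear_of pl); split=> // [v|x] /=.
    (* P a is 0 or 1, so that there is at most one index. *)
    apply/rowP => i; rewrite mxE (bigD1 i) //= big1 ?addr0.
      exact: (mulr1 (v 0 i)).
    move=> j; case/eqP; case: (P a) i j {v sl pl} => -[i hi] [j hj] //.
    by apply: val_inj; case: i j hi hj => [|i] [|j].
  rewrite /grade_proj -[x in RHS](mulr1 (x : A)) -[x * 1]/((x : A) *: vac A 0).
  rewrite linearZ /= extmx_vac.
  rewrite (eq_bigr (fun=> (x : A) *: vac A 0)) => [|i _]; last by rewrite mxE.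
  rewrite sumr_const card_ord scalerMnl scalerA; congr (_ *: _).
  by rewrite /indic mulr_natr.
have [r1 [s1 [p1 [e1 k1 g1]]]] := IH a.
have [r2 [s2 [p2 [e2 k2 g2]]]] := IH a.+1.
have sl : linear (fun v : 'rV[A]_(r1 + r2) =>
    ext_pair (s1 (lsubmx v)) (s2 (rsubmx v))).
  by move=> c u v; rewrite ext_pairZ ext_pairD -!linearP.
have pl : linear (fun x : ext A k.+1 => row_mx (p1 x.1) (p2 x.2)).
  by move=> c x y; rewrite scale_row_mx add_row_mx -!linearP.
exists (r1 + r2)%N, (linear_of sl), (linear_of pl); split.
- by rewrite e1 e2.
- by move=> v /=; rewrite k1 k2 hsubmxK.
- by elim/extP => x y; rewrite /= row_mxKl row_mxKr g1 g2 grade_proj_pair.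
Qed.

End Grading.

(** * The image of an idempotent endomorphism *)

Section Fixsub.
Variables (A : comPzRingType) (V : lmodType A) (Pi : {linear V -> V}).

(** For an idempotent Pi the image consists of the fixed points, which makes it
    a decidable submodule. *)
Definition fixpred : {pred V} := [pred x | Pi x == x].

Fact fixpred_closed : submod_closed fixpred.
Proof.
split=> [|a x y]; rewrite !inE ?linear0 // => /eqP ex /eqP ey.
by rewrite linearP ex ey.
Qed.
HB.instance Definition _ := GRing.isSubmodClosed.Build A V fixpred fixpred_closed.

Record fixsub := Fixsub { fix_val :> V; _ : fix_val \in fixpred }.
HB.instance Definition _ := [isSub for fix_val].
HB.instance Definition _ := [Choice of fixsub by <:].
HB.instance Definition _ := [SubChoice_isSubLmodule of fixsub by <:].

Lemma fix_valP (x : fixsub) : Pi (val x) = val x.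
Proof. by apply/eqP; have := valP x. Qed.

Hypothesis Pi_idem : forall x, Pi (Pi x) = Pi x.

Fact fix_proj_subproof x : Pi x \in fixpred.
Proof. by rewrite inE Pi_idem. Qed.

Definition fix_proj_fun x : fixsub := Fixsub (fix_proj_subproof x).

Lemma fix_proj_is_linear : linear fix_proj_fun.
Proof. by move=> a x y; apply: val_inj; rewrite /= linearP. Qed.

Definition fix_proj : {linear V -> fixsub} := linear_of fix_proj_is_linear.

Lemma val_fix_proj x : val (fix_proj x) = Pi x. Proof. by []. Qed.

Lemma fix_projK : cancel (val : {linear fixsub -> V}) fix_proj.
Proof. by move=> x; apply: val_inj; rewrite val_fix_proj fix_valP. Qed.
End Fixsub.

(** * The representation attached to a point *)

(** The row space of N plays the role of Q, the kernel of N being L. *)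
Section ExtRep.
Variables (A : comPzRingType) (m n : nat).
Variables (N : 'M[A]_m.+1) (theta : 'M[A]_(m.+1, n)).
Hypothesis NN : N *m N = N.
Hypothesis Ntheta : N *m theta = theta.
Hypothesis Nrank : forall (F : fieldType) (phi : {rmorphism A -> F}),
  \rank (map_mx phi N) = m.

(** The projection onto the part of degree m+1-a of the exterior algebra of
    the row space of N. *)
Definition ext_proj a : ext A m.+1 -> ext A m.+1 :=
  extmx (indic A (pred1 m.+1)) N a.
HB.instance Definition _ a := GRing.Linear.on (ext_proj a).

Lemma ext_proj_idem a x : ext_proj a (ext_proj a x) = ext_proj a x.
Proof.
rewrite /ext_proj extmx_comp NN; apply: extmx_ext => b.
by rewrite /indic -natrM mulnb andbb.
Qed.

Lemma ext_proj_wedge a v x :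
  ext_proj a (wedge v x) = wedge (v *m N) (ext_proj a.+1 x).
Proof. exact: extmx_wedge. Qed.

(** As N theta = theta, the columns of theta are linear forms on Q. *)
Lemma ext_proj_contract a j x :
  ext_proj a.+1 (contract (col j theta) x) = contract (col j theta) (ext_proj a x).
Proof. by rewrite contract_extmx colE mulmxA Ntheta. Qed.

Lemma ext_proj_vac a :
  ext_proj a (vac A m.+1) = indic A (pred1 m.+1) a *: vac A m.+1.
Proof. exact: extmx_vac. Qed.

(** Λ^(m+1-a) Q. *)
Definition ext_mod a : lmodType A := fixsub (ext_proj a).
Definition emb a : {linear ext_mod a -> ext A m.+1} :=
  (val : {linear fixsub (ext_proj a) -> ext A m.+1}).
Definition proj a : {linear ext A m.+1 -> ext_mod a} := fix_proj (@ext_proj_idem a).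

Lemma emb_inj a : injective (emb a). Proof. exact: val_inj. Qed.
Lemma emb_proj a x : emb a (proj a x) = ext_proj a x. Proof. by []. Qed.
Lemma proj_emb a : cancel (emb a) (proj a). Proof. exact: fix_projK. Qed.
Lemma ext_proj_emb a x : ext_proj a (emb a x) = emb a x.
Proof. exact: fix_valP. Qed.

(** At a field-valued point N = c r with r c = 1 of size m.  Hence ΛN is Λc
    followed by Λr, and its image is identified with the exterior algebra of a
    space of dimension m. *)
Lemma ext_mod_rank a :
  projective_of_rank (if (a <= m.+1)%N then 'C(m, m.+1 - a) else 0%N) (ext_mod a).
Proof.
split.
  have [r [s [p [_ _ sp]]]] := grade_proj_factor A predT m.+1 a.
  exists r, (p \o emb a), (proj a \o s) => x /=.
  rewrite sp /grade_proj (extmx_ext _ (w' := fun => 1)) // extmx1.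
  exact: proj_emb.
move=> F phi; rewrite -grade_rank_pred1.
set N' := map_mx phi N.
have N'N' : N' *m N' = N' by rewrite -map_mxM NN.
rewrite -[X in grade_rank _ X](Nrank phi) -/N'.
have [r [s [p [rE sK sp]]]] := grade_proj_factor F (pred1 m.+1) (\rank N') a.
rewrite -rE.
pose up : {linear ext F (\rank N') -> ext F m.+1} :=
  extmx (fun=> 1) (row_base N') a.
pose down : {linear ext F m.+1 -> ext F (\rank N')} :=
  extmx (fun=> 1) (col_base N') a.
have downK : cancel up down.
  move=> x; rewrite /up /down /= extmx_comp (extmx_ext _ (w' := fun => 1)).
    by rewrite row_col_base_idempotent // extmx1.
  by move=> b; rewrite mulr1.
apply: (@bc_summand A F phi (ext_mod a) _ 'rV_r _ (emb a) (proj a)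
  (up \o s) (p \o down) (@ext_map A F phi m.+1) (@proj_emb a)).
- by move=> v /=; rewrite downK sK.
- move=> x; rewrite /= sp /grade_proj !extmx_comp mul1mx mulmx_base.
  rewrite -[RHS]/(ext_map phi (ext_proj a x)) ext_map_extmx -/N'.
  refine (@extmx_ext F _ _ _ _ N' a _ _) => b.
  by rewrite /= /indic mulr1 mul1r rmorph_nat.
- exact: bc_ext.
Qed.

(** For a = 0 this is the vanishing of Λ^(m+1) Q for Q of rank m.  It is what
    makes the relations hold at the vertex 1, where the paths through the
    vertex 0 are dropped. *)
Lemma ext_mod0 a (x : ext_mod a) : ~~ (0 < a <= m.+1)%N -> x = 0.
Proof.
move=> ha; apply: (rank0_eq0 (P := ext_mod a)).
have := ext_mod_rank a; case: ifP ha => // am; rewrite andbT -eqn0Ngt => /eqP ->.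
by rewrite subn0 bin_small.
Qed.

Definition ext_g (j : 'I_n) a : {linear ext_mod a -> ext_mod a.+1} :=
  proj a.+1 \o (contract (col j theta) \o emb a).
Definition ext_l (i : 'I_m.+1) a : {linear ext_mod a.+1 -> ext_mod a} :=
  proj a \o (wedge (row i N) \o emb a.+1).

Lemma emb_g j a x : emb a.+1 (ext_g j a x) = contract (col j theta) (emb a x).
Proof. by rewrite /= ext_proj_contract ext_proj_emb. Qed.

Lemma emb_l i a x : emb a (ext_l i a x) = wedge (row i N) (emb a.+1 x).
Proof. by rewrite /= ext_proj_wedge ext_proj_emb -row_mul NN. Qed.

(** The anticommutators are scalars; this gives the two cubic relations. *)
Lemma ext_clifford i j a x :
  ext_l i a.+1 (ext_g j a.+1 x) + ext_g j a (ext_l i a x) = theta i j *: x.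
Proof.
apply: (@emb_inj a.+1).
rewrite linearD linearZ emb_l !emb_g emb_l addrC contract_wedge.
congr (_ *: _); rewrite -[in RHS]Ntheta !mxE.
by apply: eq_bigr => k _; rewrite !mxE.
Qed.

Fact ext_ll i j a x : ext_l i a (ext_l j a.+1 x) + ext_l j a (ext_l i a.+1 x) = 0.
Proof. by apply: (@emb_inj a); rewrite linearD !emb_l wedge_anti linear0. Qed.

Fact ext_l2 i a x : ext_l i a (ext_l i a.+1 x) = 0.
Proof. by apply: (@emb_inj a); rewrite !emb_l wedge_sq linear0. Qed.

Fact ext_gg i j a x : ext_g i a.+1 (ext_g j a x) + ext_g j a.+1 (ext_g i a x) = 0.
Proof. by apply: (@emb_inj a.+2); rewrite linearD !emb_g contract_anti linear0. Qed.

Fact ext_g2 i a x : ext_g i a.+1 (ext_g i a x) = 0.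
Proof. by apply: (@emb_inj a.+2); rewrite !emb_g contract_sq linear0. Qed.

Definition ext_rep : qrep m.+1 n A.
Proof.
apply: (@QRep m.+1 n A ext_mod ext_g ext_l).
- by move=> a ha x; apply: ext_mod0.
- exact: ext_ll.
- exact: ext_l2.
- exact: ext_gg.
- exact: ext_g2.
- by move=> k i j a x; rewrite !ext_clifford linearZ.
- by move=> l i j a x; rewrite !ext_clifford linearZ.
Defined.

End ExtRep.

(** * The point classified by a representation *)

Lemma rank_compl (F : fieldType) k (E : 'M[F]_k) : E *m E = E ->
  \rank (1%:M - E) = (k - \rank E)%N.
Proof.
move=> EE; rewrite -mxrank_ker; apply: eqmx_rank; apply/andP; split.
  by apply/sub_kermxP; rewrite mulmxBl mul1mx EE subrr.
apply/row_subP => i; have /sub_kermxP := row_sub i (kermx E).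
set u := row i _ => uE.
by rewrite -[u](_ : u *m (1%:M - E) = u) ?submxMl // mulmxBr mulmx1 uE subr0.
Qed.

(** A direct summand L of rank one is the kernel of an idempotent of corank one,
    namely of the complementary projection. *)
Lemma proj_pointP (A : comPzRingType) m (L : set 'rV[A]_m.+1) : proj_point L <->
  exists N : 'M[A]_m.+1, [/\ N *m N = N,
    forall (F : fieldType) (phi : {rmorphism A -> F}), \rank (map_mx phi N) = m
    & L = [set v | v *m N = 0]].
Proof.
split=> [[P [i [p [iK rL /(projective_of_rankP iK) rk]]]]|[N [NN rk ->]]].
  set E := summand_mx i p in rk; have EE : E *m E = E := summand_mx_idem iK.
  exists (1%:M - E); split=> [|F phi|].
  - by rewrite mulmxBl !mulmxBr !mul1mx !mulmx1 EE subrr subr0.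
  - by rewrite map_mxB map_mx1 rank_compl ?rk ?subn1 // -map_mxM EE.
  rewrite -rL; apply/seteqP; split=> [_ [x _ <-]|v] /=.
    by rewrite mulmxBr mulmx1 mul_summand_mx iK subrr.
  rewrite mulmxBr mulmx1 mul_summand_mx => /eqP; rewrite subr_eq0 => /eqP ->.
  by exists (p v).
pose E := 1%:M - N.
have EE u : mulmxr E (mulmxr E u) = mulmxr E u :> 'rV_m.+1.
  by rewrite /= -mulmxA mulmxBl !mulmxBr !mul1mx !mulmx1 NN subrr subr0.
pose i := (val : {linear fixsub (mulmxr E : {linear 'rV[A]_m.+1 -> _}) ->
                         'rV[A]_m.+1}).
have iK : cancel i (fix_proj EE) := fix_projK EE.
exists _, i, (fix_proj EE); split=> //.
  apply/seteqP; split=> [_ [x _ <-]|v] /=.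
    have := fix_valP x => /=; rewrite mulmxBr mulmx1 => /eqP.
    by rewrite -subr_eq0 addrAC subrr sub0r oppr_eq0 => /eqP.
  by move=> vN; exists (fix_proj EE v) => //=; rewrite mulmxBr mulmx1 vN subr0.
apply/(projective_of_rankP iK) => F phi.
rewrite (_ : summand_mx _ _ = E); last first.
  by apply/row_matrixP => j; rewrite !rowE mul_summand_mx.
by rewrite map_mxB map_mx1 rank_compl ?rk ?subSnn // -map_mxM NN.
Qed.

Section Generation.
Variables (A : comPzRingType) (m n : nat) (W : qrep m.+1 n A).

(** Generation is expressed at every index, also above the top vertex, where
    0 is only reached through an arrow g: hence the hypothesis on n. *)
Lemma gen_top0 (hn : (0 < n)%N) a : gen_top (0 : W a).
Proof.
have up b : gen_top (0 : W b) -> gen_top (0 : W b.+1).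
  by move=> g0; rewrite -(linear0 (rep_g W (Ordinal hn) b)); apply: gen_g.
have down b : gen_top (0 : W b.+1) -> gen_top (0 : W b).
  by move=> g0; rewrite -(linear0 (rep_l W ord0 b)); apply: gen_l.
have bottom b : gen_top (0 : W b) -> gen_top (0 : W 0).
  by elim: b => [//|b IH] /down.
by elim: a => [|b]; [apply: bottom (gen_in 0) | apply: up].
Qed.

Lemma gen_top_sum (hn : (0 < n)%N) a I (r : seq I) (c : I -> A) (F : I -> W a) :
  (forall i, gen_top (F i)) -> gen_top (\sum_(i <- r) c i *: F i).
Proof.
move=> gF; elim: r => [|i r IH]; first by rewrite big_nil; apply: gen_top0.
by rewrite big_cons; apply: gen_lin.
Qed.
End Generation.

Definition lambda_act (A : comPzRingType) m n (W : qrep m.+1 n A)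
    (v : 'rV[A]_m.+1) a (x : W a.+1) : W a := \sum_i v 0 i *: rep_l W i a x.

Lemma lambda_act_is_linear (A : comPzRingType) m n (W : qrep m.+1 n A) v a :
  linear (@lambda_act A m n W v a).
Proof.
move=> c x y; rewrite /lambda_act scaler_sumr -big_split; apply: eq_bigr => i _ /=.
by rewrite linearP scalerDr !scalerA mulrC.
Qed.
HB.instance Definition _ (A : comPzRingType) m n (W : qrep m.+1 n A) v a :=
  GRing.isLinear.Build A (W a.+1) (W a) *:%R (@lambda_act A m n W v a)
    (@lambda_act_is_linear A m n W v a).

Lemma lambda_act_linearl (A : comPzRingType) m n (W : qrep m.+1 n A) a
    (x : W a.+1) :
  linear (fun v => lambda_act v x).
Proof.
move=> c u v; rewrite /lambda_act scaler_sumr -big_split; apply: eq_bigr => i _ /=.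
by rewrite !mxE scalerDl scalerA.
Qed.

Definition lambda_act_on (A : comPzRingType) m n (W : qrep m.+1 n A) a
    (x : W a.+1) : {linear 'rV[A]_m.+1 -> W a} :=
  linear_of (lambda_act_linearl x).

Lemma lambda_act_delta (A : comPzRingType) m n (W : qrep m.+1 n A) i a
    (x : W a.+1) :
  lambda_act (delta_mx 0 i) x = rep_l W i a x.
Proof.
rewrite /lambda_act (bigD1 i) //= big1 => [|j ji]; rewrite mxE ?eqxx.
  by rewrite scale1r addr0.
by rewrite (negPf ji) scale0r.
Qed.

(** The point z that W defines: the line of linear relations between the
    lambda_i at the top vertex, and the scalars g_j lambda_i. *)
Definition classified (A : comPzRingType) m n (W : qrep m.+1 n A)
    (z : Zpoint m.+1 n A) :=
  Zline z = [set v | forall w : W m.+1, lambda_act v w = 0] /\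
  forall i j (w : W m.+1), rep_g W j m (rep_l W i m w) = Zmat z i j *: w.

Section ExtModuli.
Variables (A : comPzRingType) (m n : nat) (hn : (0 < n)%N).
Variables (N : 'M[A]_m.+1) (theta : 'M[A]_(m.+1, n)).
Hypothesis NN : N *m N = N.
Hypothesis Ntheta : N *m theta = theta.
Hypothesis Nrank : forall (F : fieldType) (phi : {rmorphism A -> F}),
  \rank (map_mx phi N) = m.
Let W := ext_rep NN Ntheta Nrank.

(** The component of degree 0, obtained by letting all vectors act as zero. *)
Definition vac_coef k : ext A k -> A^o :=
  elift (V := fun=> A^o) (fun=> 1) (fun _ _ => \0 : {linear A^o -> A^o}) 0.

Lemma vac_coef_is_linear k : linear (@vac_coef k).
Proof. exact: (@elift_is_linear A (fun=> A^o)). Qed.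
HB.instance Definition _ k := GRing.isLinear.Build A (ext A k) A^o *:%R
  (@vac_coef k) (@vac_coef_is_linear k).

Lemma vac_coef_vac k : vac_coef (vac A k) = 1.
Proof. exact: (@elift_vac A (fun=> A^o)). Qed.

Lemma vac_coef_wedge k v (x : ext A k) : vac_coef (wedge v x) = 0.
Proof.
rewrite /vac_coef (@elift_wedge A (fun=> A^o)) ?big1 // => [i _|].
  by rewrite scaler0.
by split=> * //=; rewrite addr0.
Qed.

Lemma wedge_vac_eq0 k (v : 'rV[A]_k) : wedge v (vac A k) = 0 -> v = 0.
Proof.
move=> v0; apply/rowP => j; rewrite mxE.
have := contract_wedge (delta_mx j 0) v (vac A k).
rewrite v0 contract_vac !linear0 addr0 -colE mxE => /esym/(congr1 (@vac_coef k)).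
by rewrite linearZ linear0 /= vac_coef_vac => <-; rewrite [RHS]mulr1.
Qed.

Lemma ext_proj_top (x : ext A m.+1) : ext_proj N m.+1 x = vac_coef x *: vac A m.+1.
Proof.
elim/ext_ind: x => [|c x y IHx IHy|v x _].
- by rewrite ext_proj_vac vac_coef_vac /indic /= eqxx.
- rewrite linearP /= IHx IHy scalerA -scalerDl; congr (_ *: _).
  by rewrite linearP.
- rewrite ext_proj_wedge vac_coef_wedge scale0r -(emb_proj NN).
  by rewrite (ext_mod0 NN Nrank (proj _ _ _)) ?linear0 // ltnn andbF.
Qed.

Lemma proj_vac a : a <> m.+1 -> proj NN a (vac A m.+1) = 0.
Proof.
move=> am; apply: emb_inj; rewrite emb_proj ext_proj_vac linear0 /indic /=.
by case: eqP am => // _ _; rewrite scale0r.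
Qed.

(** The projection to ΛQ of a product of vectors v_1 /\ ... /\ v_d is obtained by
    letting the classes of the v_i act successively on 1. *)
Lemma ext_rep_gen a (x : W a) : gen_top x.
Proof.
rewrite -(proj_emb NN (x : ext_mod N a)); move: (emb N a x) => {x} x.
elim/ext_ind: x => [|c x y IHx IHy|v x IHx] in a *.
- have [->|am] := pselect (a = m.+1); first exact: gen_in.
  by rewrite (proj_vac am); apply: gen_top0.
- by rewrite linearP; apply: gen_lin.
rewrite (_ : proj _ _ _ =
  \sum_i v 0 i *: rep_l W i a (proj NN a.+1 x)); last first.
  apply: emb_inj.
  rewrite emb_proj ext_proj_wedge mulmx_sum_row wedge_suml linear_sum.
  by apply: eq_bigr => i _; rewrite linearZ wedgeZl -(emb_proj NN) -(emb_l NN).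
by apply: gen_top_sum => // i; apply: gen_l.
Qed.

Lemma ext_rep_moduli : moduli_rep W.
Proof.
split; last exact: ext_rep_gen.
  move=> [//|a] /andP[_ am]; have := ext_mod_rank NN Nrank a.+1.
  by rewrite am subSS bin_sub.
have e : emb N m.+1 (proj NN m.+1 (vac A m.+1)) = vac A m.+1.
  by rewrite emb_proj ext_proj_top vac_coef_vac scale1r.
exists (@vac_coef m.+1 \o emb N m.+1).
exists (fun c : A^o => (c : A) *: proj NN m.+1 (vac A m.+1)) => [x|c].
  by apply: emb_inj; rewrite linearZ e -[RHS]ext_proj_emb ext_proj_top.
change (vac_coef (emb N m.+1 ((c : A) *: proj NN m.+1 (vac A m.+1))) = c).
rewrite linearZ e -[RHS](mulr1 (c : A)); congr (_ * _); exact: vac_coef_vac.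
Qed.

Lemma emb_lambda_act v a (x : W a.+1) :
  emb N a (lambda_act v x) = wedge (v *m N) (emb N a.+1 x).
Proof.
rewrite mulmx_sum_row wedge_suml linear_sum; apply: eq_bigr => i _.
by rewrite linearZ wedgeZl -(emb_l NN).
Qed.

Lemma ext_rep_classified (z : Zpoint m.+1 n A) :
  Zline z = [set v | v *m N = 0] -> Zmat z = theta -> classified W z.
Proof.
rewrite /classified => -> ->; split=> [|i j w].
  apply/seteqP; split=> v /= => [vN w|].
    by apply: emb_inj; rewrite emb_lambda_act vN wedge0l linear0.
  move=> /(_ (proj NN m.+1 (vac A m.+1)))/(congr1 (@emb _ _ N m)).
  rewrite emb_lambda_act emb_proj ext_proj_top vac_coef_vac scale1r linear0.
  exact: wedge_vac_eq0.
rewrite -(ext_clifford NN Ntheta i j w) (ext_mod0 NN Nrank (ext_g _ _ _ _ _)).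
  by rewrite linear0 add0r.
by rewrite ltnn andbF.
Qed.
End ExtModuli.

(** * A representation is determined by its point *)

Lemma projective_of_rank0 (A : comPzRingType) (P : lmodType A) :
  (forall x : P, x = 0) -> projective_of_rank 0 P.
Proof.
move=> P0; pose s := (\0 : {linear P -> 'rV[A]_0}).
pose p := (\0 : {linear 'rV[A]_0 -> P}).
have sK : cancel s p by move=> x; rewrite [LHS]P0 [RHS]P0.
apply/(projective_of_rankP sK) => F phi; apply/eqP.
by rewrite -leqn0 rank_leq_row.
Qed.

Lemma above_top0 (A : comPzRingType) m n (W : qrep m.+1 n A) (x : W m.+2) : x = 0.
Proof. by apply: rep_out; rewrite ltnn andbF. Qed.

Section TopGenerator.
Variables (A : comPzRingType) (m n : nat) (W : qrep m.+1 n A) (w0 : W m.+1).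
Hypothesis w0_gen : forall w : W m.+1, exists c : A, w = c *: w0.

(** The components of w0, viewed in the direct sum of all the W_a. *)
Definition wtop a : W a :=
  if eqVneq m.+1 a is EqNotNeq e then ecast b (W b) e w0 else 0.

Lemma wtop_top : wtop m.+1 = w0.
Proof. by rewrite /wtop; case: eqVneq => [e|/eqP//]; rewrite (eq_axiomK e). Qed.

Lemma wtop_out a : m.+1 != a -> wtop a = 0.
Proof. by rewrite /wtop; case: eqVneq. Qed.

(** The map from the exterior algebra of A^(m+1) to W sending a product of basis
    vectors to the corresponding product of lambda_i applied to w0. *)
Definition ext_eval a : ext A m.+1 -> W a := elift wtop (rep_l W) a.

Lemma ext_eval_is_linear a : linear (ext_eval a).
Proof. exact: elift_is_linear. Qed.
HB.instance Definition _ a := GRing.isLinear.Build A (ext A m.+1) (W a) *:%R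
  (ext_eval a) (ext_eval_is_linear a).

Lemma ext_eval_vac a : ext_eval a (vac A m.+1) = wtop a.
Proof. exact: elift_vac. Qed.

Lemma ext_eval_wedge a v x :
  ext_eval a (wedge v x) = lambda_act v (ext_eval a.+1 x).
Proof. by apply: elift_wedge; split=> *; [apply: rep_l2|apply: rep_ll]. Qed.

Hypothesis hn : (0 < n)%N.
Variable theta : 'M[A]_(m.+1, n).
Hypothesis w0_theta : forall i j, rep_g W j m (rep_l W i m w0) = theta i j *: w0.

(** True on w0 by definition of theta, and propagated by the lambda_k since they
    commute with the anticommutator. *)
Lemma ext_eval_clifford i j a x :
  rep_l W i a.+1 (rep_g W j a.+1 (ext_eval a.+1 x)) +
    rep_g W j a (rep_l W i a (ext_eval a.+1 x)) = theta i j *: ext_eval a.+1 x.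
Proof.
elim/ext_ind: x => [|c x y IHx IHy|v x IHx] in a *.
- rewrite ext_eval_vac; have [<-|am] := eqVneq m a.
    rewrite wtop_top w0_theta (above_top0 (rep_g W j m.+1 w0)).
    by rewrite linear0 add0r.
  by rewrite wtop_out ?eqSS // !linear0 addr0.
- by rewrite !linearP addrACA -scalerDr IHx IHy.
rewrite ext_eval_wedge /lambda_act !linear_sum -big_split; apply: eq_bigr => k _ /=.
rewrite !linearZ -scalerDr /= -rep_lgl IHx linearZ /= !scalerA.
by rewrite mulrC.
Qed.

(** On w0 both sides vanish, g_j w0 lying above the top vertex; then both sides
    are moved through an exterior product by the Clifford relation. *)
Lemma ext_eval_contract j a x :
  ext_eval a.+1 (contract (col j theta) x) = rep_g W j a (ext_eval a x).
Proof.
elim/ext_ind: x => [|c x y IHx IHy|v x IHx] in a *.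
- rewrite ext_eval_vac contract_vac linear0; have [<-|am] := eqVneq m.+1 a.
    by rewrite [RHS]above_top0.
  by rewrite wtop_out // linear0.
- by rewrite !linearP /= IHx IHy.
rewrite -[contract _ _](addrK (wedge v (contract (col j theta) x))) contract_wedge.
rewrite linearB linearZ /= !ext_eval_wedge IHx /lambda_act [RHS]linear_sum.
rewrite mxE scaler_suml -sumrB.
apply: eq_bigr => i _; rewrite [RHS]linearZ mxE -scalerA -ext_eval_clifford.
by rewrite -scalerBr addrAC subrr add0r.
Qed.

(** The image is stable under all the arrows and contains w0. *)
Lemma ext_eval_surj a (y : W a) : gen_top y -> exists x, ext_eval a x = y.
Proof.
elim=> {a y} [w|a c y1 y2 _ [x1 <-] _ [x2 <-]|j a y _ [x <-]|i a y _ [x <-]].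
- have [c ->] := w0_gen w; exists (c *: vac A m.+1).
  by rewrite linearZ /= ext_eval_vac wtop_top.
- by exists (c *: x1 + x2); rewrite linearP.
- by exists (contract (col j theta) x); rewrite ext_eval_contract.
- by exists (wedge (delta_mx 0 i) x); rewrite ext_eval_wedge lambda_act_delta.
Qed.

(** A relation between the lambda_i on w0 holds everywhere, because it
    anticommutes with each lambda_i. *)
Lemma ext_eval_wedge_ker a v x : lambda_act v w0 = 0 -> ext_eval a (wedge v x) = 0.
Proof.
move=> vw0; elim/ext_ind: x => [|c x y IHx IHy|u x IHx] in a *.
- rewrite ext_eval_wedge ext_eval_vac; have [<-|am] := eqVneq m a.
    by rewrite wtop_top.
  by rewrite wtop_out ?linear0 // eqSS.
- by rewrite !linearP /= IHx IHy scaler0 addr0.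
have /eqP := wedge_anti v u x; rewrite addr_eq0 => /eqP ->.
by rewrite linearN /= ext_eval_wedge IHx linear0 oppr0.
Qed.

(** Since the line L acts by zero, the evaluation factors through ΛQ. *)
Lemma ext_eval_proj (N : 'M[A]_m.+1) a x :
  (forall v, lambda_act (v - v *m N) w0 = 0) ->
  ext_eval a (ext_proj N a x) = ext_eval a x.
Proof.
move=> hN; elim/ext_ind: x => [|c x y IHx IHy|v x IHx] in a *.
- rewrite ext_proj_vac linearZ /= ext_eval_vac /indic /=.
  by case: eqVneq => [->|am]; rewrite ?scale1r // wtop_out ?scaler0 // eq_sym.
- by rewrite !linearP /= IHx IHy.
rewrite ext_proj_wedge [RHS]ext_eval_wedge -IHx -ext_eval_wedge; apply/eqP.
rewrite -subr_eq0 -opprB oppr_eq0 -linearB /= -scaleN1r -wedgeZl -wedgeDl.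
by rewrite scaleN1r ext_eval_wedge_ker.
Qed.

Section Iso.
Variable N : 'M[A]_m.+1.
Hypothesis NN : N *m N = N.
Hypothesis Ntheta : N *m theta = theta.
Hypothesis Nrank : forall (F : fieldType) (phi : {rmorphism A -> F}),
  \rank (map_mx phi N) = m.
Hypothesis hN : forall v, lambda_act (v - v *m N) w0 = 0.
Hypothesis Wmod : moduli_rep W.

(** The restriction to ΛQ of the evaluation is surjective, between projective
    modules of the same rank. *)
Lemma ext_rep_iso : rep_iso (ext_rep NN Ntheta Nrank) W.
Proof.
have [Wrk _ Wgen] := Wmod.
exists (fun a => ext_eval a \o emb N a); split=> [a|j a x|i a x].
- have [am|am] := boolP (0 < a <= m.+1)%N; last first.
    (* Both sides vanish outside the vertices 1, ..., m+1. *)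
    exists (fun=> 0) => x; last by rewrite [RHS](rep_out am) linear0.
    by rewrite [RHS](ext_mod0 NN Nrank).
  apply: surj_same_rank_inj (Wrk a am) _.
    have [rk _ _] := ext_rep_moduli hn NN Ntheta Nrank.
    exact: rk.
  move=> y; have [x <-] := ext_eval_surj (Wgen _ y).
  by exists (proj NN a x); apply: ext_eval_proj.
- rewrite -[LHS]/(ext_eval a.+1 (emb N a.+1 (ext_g theta NN j a x))).
  rewrite (emb_g NN Ntheta); exact: ext_eval_contract.
- rewrite -[LHS]/(ext_eval a (emb N a (ext_l NN i a x))) emb_l.
  rewrite -lambda_act_delta -ext_eval_wedge; apply/eqP.
  rewrite -subr_eq0 -opprB oppr_eq0 -linearB /=.
  by rewrite -scaleN1r -wedgeZl -wedgeDl scaleN1r rowE ext_eval_wedge_ker.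
Qed.
End Iso.

End TopGenerator.

(** * The bijection and its naturality *)

Lemma can_linear (A : comPzRingType) (M N : lmodType A) (f : {linear M -> N}) g :
  cancel f g -> cancel g f -> linear g.
Proof. by move=> fK gK a x y; apply: (can_inj fK); rewrite linearP !gK. Qed.

Lemma rep_iso_sym (A : comPzRingType) m n (W W' : qrep m n A) :
  rep_iso W W' -> rep_iso W' W.
Proof.
move=> [f [fb fg fl]].
have inv a : {g : {linear W' a -> W a} | cancel (f a) g /\ cancel g (f a)}.
  apply: cid; have [g fK gK] := fb a.
  by exists (linear_of (can_linear fK gK)).
exists (fun a => sval (inv a)); split=> [a|j a x|i a x].
- by case: (inv a) => g [/= fK gK]; exists (f a).
- case: (inv a) (inv a.+1) => g [/= fK gK] [g' [/= fK' gK']].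
  by rewrite -[x in LHS]gK -fg fK'.
- case: (inv a) (inv a.+1) => g [/= fK gK] [g' [/= fK' gK']].
  by rewrite -[x in LHS]gK' -fl fK.
Qed.

Lemma rep_iso_trans (A : comPzRingType) m n (W1 W2 W3 : qrep m n A) :
  rep_iso W1 W2 -> rep_iso W2 W3 -> rep_iso W1 W3.
Proof.
move=> [f [fb fg fl]] [g [gb gg gl]]; exists (fun a => g a \o f a).
split=> [a|j a x|i a x] /=; first exact: bij_comp (gb a) (fb a).
  by rewrite fg gg.
by rewrite fl gl.
Qed.

Section ModuliRep.
Variables (A : comPzRingType) (m n : nat) (W : qrep m.+1 n A).
Hypothesis Wmod : moduli_rep W.

Lemma top_generator : exists w0 : W m.+1,
  (forall w, exists c : A, w = c *: w0) /\ (forall c : A, c *: w0 = 0 -> c = 0).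
Proof.
have [_ [f [g fK gK]] _] := Wmod; exists (g 1).
have fw0 c : f (c *: g 1) = c by rewrite linearZ /= gK; apply: mulr1.
split=> [w|c c0]; first by exists (f w); apply: (can_inj fK); rewrite fw0.
by rewrite -[c]fw0 c0 linear0.
Qed.

Lemma subtop_rank : projective_of_rank m (W m).
Proof.
have [Wrk _ _] := Wmod; case: m W Wmod Wrk => [|p] W' _ Wrk.
  by apply: projective_of_rank0 => x; apply: rep_out.
by rewrite -[X in projective_of_rank X _]binSn; apply: Wrk; rewrite /= leqnSn.
Qed.


Variable w0 : W m.+1.
Hypothesis w0_gen : forall w, exists c : A, w = c *: w0.

(** W_m is projective and spanned by the lambda_i w0.  A section t presents it as
    a summand of the row vectors, with complement the line L. *)
Lemma subtop_section : exists t : {linear W m -> 'rV[A]_m.+1},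
  forall y, lambda_act (t y) w0 = y.
Proof.
have [_ _ Wgen] := Wmod.
have [theta w0_theta] : exists theta : 'M[A]_(m.+1, n),
    forall i j, rep_g W j m (rep_l W i m w0) = theta i j *: w0.
  have /choice[th thE] : forall ij, exists c : A,
      rep_g W ij.2 m (rep_l W ij.1 m w0) = c *: w0 by move=> ij; apply: w0_gen.
  by exists (\matrix_(i, j) th (i, j)) => i j; rewrite mxE -thE.
have [|t tK] := linear_section (h := lambda_act_on w0) subtop_rank.1; last first.
  by exists t.
move=> y; have [x <-] := ext_eval_surj w0_gen w0_theta (Wgen _ y).
elim/ext_ind: x => [|c x1 x2 [v1 e1] [v2 e2]|v x _] {y}.
- exists 0; rewrite linear0 ext_eval_vac wtop_out // neq_ltn ltnSn orbT //.
- by exists (c *: v1 + v2); rewrite !linearP e1 e2.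
(* The inner factor x is evaluated in W_(m+1), a multiple of w0. *)
- have [c cE] := w0_gen (ext_eval w0 m.+1 x).
  by exists (c *: v); rewrite ext_eval_wedge cE !linearZ.
Qed.

Lemma lambda_act_top v :
  lambda_act v w0 = 0 -> forall w : W m.+1, lambda_act v w = 0.
Proof. by move=> v0 w; have [c ->] := w0_gen w; rewrite linearZ /= v0 scaler0. Qed.

End ModuliRep.

(** The matrix N of the projection on W_m has kernel L and rank m, so L is a
    point of projective space. *)
Lemma moduli_zpoint (A : comPzRingType) m n (W : qrep m.+1 n A) :
  moduli_rep W -> exists z, classified W z.
Proof.
move=> Wmod; have [w0 [w0_gen w0_free]] := top_generator Wmod.
have [t tK] := subtop_section Wmod w0_gen.
have tK' : cancel t (lambda_act_on w0) := tK.
set N := summand_mx t (lambda_act_on w0).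
have mN v : v *m N = t (lambda_act v w0).
  exact: (mul_summand_mx t (lambda_act_on w0)).
pose L := [set v : 'rV[A]_m.+1 | forall w : W m.+1, lambda_act v w = 0].
have Lpt : proj_point L.
  apply/proj_pointP; exists N; split; first exact: summand_mx_idem.
    by apply/(projective_of_rankP tK'); apply: subtop_rank.
  apply/seteqP; split=> v /= => [vL|]; rewrite mN; first by rewrite vL linear0.
  move=> t0; apply: (lambda_act_top w0_gen).
  by rewrite -[LHS]tK t0; apply: (linear0 (lambda_act_on w0)).
have /choice[th thE] : forall ij : 'I_m.+1 * 'I_n, exists c : A,
    rep_g W ij.2 m (rep_l W ij.1 m w0) = c *: w0 by move=> ij; apply: w0_gen.
pose theta := \matrix_(i, j) th (i, j).
have thetaE i j (w : W m.+1) : rep_g W j m (rep_l W i m w) = theta i j *: w.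
  have [c ->] := w0_gen w; rewrite !linearZ /= mxE (thE (i, j)).
  by rewrite !scalerA mulrC.
have Leq v : L v -> v *m theta = 0.
  move=> Lv; apply/rowP => j; rewrite !mxE; apply: w0_free.
  rewrite scaler_suml -[RHS](linear0 (rep_g W j m)) -(Lv w0) linear_sum.
  by apply: eq_bigr => i _; rewrite linearZ /= thetaE scalerA.
by exists (ZPoint Lpt Leq); split.
Qed.

Lemma classified_uniq (A : comPzRingType) m n (W : qrep m.+1 n A) z z' :
  moduli_rep W -> classified W z -> classified W z' -> z = z'.
Proof.
move=> Wmod [Lz tz] [Lz' tz']; have [w0 [_ w0_free]] := top_generator Wmod.
have eL : Zline z = Zline z' by rewrite Lz Lz'.
have eM : Zmat z = Zmat z'.
  apply/matrixP => i j; apply/eqP; rewrite -subr_eq0; apply/eqP/w0_free.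
  by rewrite scalerBl -tz -tz' subrr.
case: z z' eL eM {Lz tz Lz' tz'} => [L M p q] [L' M' p' q'] /= eL eM.
by case: _ / eL p' q' => p' q'; case: _ / eM q' => q'; congr ZPoint;
  apply: Prop_irrelevance.
Qed.

Lemma classified_rep_iso (A : comPzRingType) m n (W W' : qrep m.+1 n A) z :
  rep_iso W W' -> classified W z -> classified W' z.
Proof.
move=> /rep_iso_sym[f [fb fg fl]] [Lz tz]; split.
  have f_act v w : f m (lambda_act v w) = lambda_act v (f m.+1 w).
    by rewrite linear_sum; apply: eq_bigr => i _; rewrite linearZ fl.
  rewrite Lz; apply/seteqP; split=> v /= h w.
    by apply: (bij_inj (fb m)); rewrite f_act h linear0.
  by have [g fK gK] := fb m.+1; rewrite -[w]gK -f_act h linear0.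
by move=> i j w; apply: (bij_inj (fb m.+1)); rewrite fg fl tz linearZ.
Qed.

(** The first two clauses give the surjectivity of the classifying map, the last
    one its injectivity. *)
Lemma zpoint_moduli (A : comPzRingType) m n (hn : (0 < n)%N) (z : Zpoint m.+1 n A) :
  exists W0 : qrep m.+1 n A, [/\ moduli_rep W0, classified W0 z &
    forall W, moduli_rep W -> classified W z -> rep_iso W0 W].
Proof.
have [N [NN Nrank LN]] := (proj_pointP _).1 (Zline_point z).
have cN v : Zline z (v - v *m N) by rewrite LN /= mulmxBl -mulmxA NN subrr.
have Ntheta : N *m Zmat z = Zmat z.
  apply/row_matrixP => i; apply/esym/eqP; rewrite -subr_eq0 !rowE mulmxA -mulmxBl.
  by rewrite Zeq.
exists (ext_rep NN Ntheta Nrank); split.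
- exact: ext_rep_moduli.
- exact: ext_rep_classified.
move=> W Wmod [Lz tz]; have [w0 [w0_gen _]] := top_generator Wmod.
apply: (ext_rep_iso (w0 := w0)) => // v.
by have := cN v; rewrite Lz /=; apply.
Qed.

Section NaturalBC.
Variables (A B : comPzRingType) (phi : {rmorphism A -> B}) (m n : nat).
Variables (W : qrep m.+1 n A) (W' : qrep m.+1 n B).

Lemma bc_eq (M : lmodType A) (M' P : lmodType B)
    (iota : {linear M -> M' | phi \; *:%R}) (h h' : {linear M' -> P}) :
  is_base_change iota -> (forall x, h (iota x) = h' (iota x)) -> h =1 h'.
Proof.
move=> bc e.
have sl a x y : h (iota (a *: x + y)) = phi a *: h (iota x) + h (iota y).
  by rewrite !linearP.
have [k [_ kU]] := bc P (semilinear_of sl) => y.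
by rewrite (kU h) // (kU h') // => x; rewrite -e.
Qed.

(** The scalars theta are transported by universality of W_(m+1).  For the line,
    the section t of W_m descends to t', so that an element v of the line of W'
    is killed by the image of N; then v = v (1 - N) is a combination of the
    images of the rows of 1 - N, which lie in the line of W. *)
Lemma classified_base_change z z' : moduli_rep W -> moduli_rep W' ->
  rep_base_change phi W W' -> classified W z -> classified W' z' ->
  Zpoint_base_change phi z z'.
Proof.
move=> Wmod Wmod' [f [fbc fg fl]] [Lz tz] [Lz' tz'].
have [w0 [w0_gen _]] := top_generator Wmod.
have [w0' [w0_gen' w0_free']] := top_generator Wmod'.
have f_act v w : f m (lambda_act v w) = lambda_act (map_mx phi v) (f m.+1 w).
  by rewrite linear_sum; apply: eq_bigr => i _; rewrite linearZ fl mxE.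
split; last first.
  apply/matrixP => i j; rewrite mxE; apply/eqP; rewrite -subr_eq0; apply/eqP.
  apply: w0_free'; rewrite scalerBl -tz'; apply/eqP; rewrite subr_eq0; apply/eqP.
  have hl : linear (fun w : W' m.+1 => phi (Zmat z i j) *: w).
    by move=> a x y; rewrite scalerDr !scalerA mulrC.
  apply: (bc_eq (h := rep_g W' j m \o rep_l W' i m) (h' := linear_of hl)
    (fbc m.+1)) => x /=.
  by rewrite -fl -fg tz linearZ.
have [t tK] := subtop_section Wmod w0_gen.
have tf_lin a x y : map_mx phi (t (a *: x + y)) =
    phi a *: map_mx phi (t x) + map_mx phi (t y).
  by rewrite linearP map_mxD map_mxZ.
have [t' [t'E _]] := fbc m _ (semilinear_of tf_lin).
have t'q (v : 'rV[B]_m.+1) : t' (lambda_act v (f m.+1 w0)) =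
    \sum_i v 0 i *: map_mx phi (t (rep_l W i m w0)).
  by rewrite linear_sum; apply: eq_bigr => i _; rewrite linearZ -fl /= t'E.
rewrite Lz'; apply/seteqP; split=> [v /= vL|v].
  exists m.+1, (v 0), (fun i => map_mx phi (delta_mx 0 i - t (rep_l W i m w0))).
  split=> [i|].
    exists (delta_mx 0 i - t (rep_l W i m w0)) => //; rewrite Lz /=.
    apply: (lambda_act_top w0_gen).
    apply: etrans (linearB (lambda_act_on w0) _ _) _.
    by rewrite /= tK lambda_act_delta subrr.
  have := t'q v; rewrite vL linear0 => e.
  rewrite [LHS]row_sum_delta -[LHS]subr0 [X in _ - X]e -sumrB.
  by apply: eq_bigr => i _; rewrite map_mxB map_delta_mx scalerBr.
move=> [k [c [s [sL ->]]]] w.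
apply: etrans (linear_sum (lambda_act_on w) _ _ _) _; rewrite big1 // => i _.
apply: etrans (linearZ_LR (lambda_act_on w) _ _) _ => /=.
have [u Lu <-] := sL i; rewrite Lz /= in Lu.
rewrite (bc_eq (h := @lambda_act B m n W' (map_mx phi u) m) (h' := \0)
  (fbc m.+1)) ?scaler0 // => x /=.
by rewrite -f_act Lu linear0.
Qed.
End NaturalBC.

Lemma Rtilde_eq (A : comPzRingType) m n (x y : Rtilde m n A) W W' :
  sval x W -> sval y W' -> rep_iso W W' -> x = y.
Proof.
case: x y => [C [W0 [mW0 CE]]] [D [W0' [mW0' DE]]] /= CW DW' WW'; apply: eq_exist.
move: CW DW'; rewrite {}CE {}DE => -[mW iW] [mW' iW'].
apply/funext => V; apply/propext; split=> -[mV iV]; split=> //.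
  apply: rep_iso_trans iW' _; apply: rep_iso_trans (rep_iso_sym WW') _.
  exact: rep_iso_trans (rep_iso_sym iW) iV.
apply: rep_iso_trans iW _; apply: rep_iso_trans WW' _.
exact: rep_iso_trans (rep_iso_sym iW') iV.
Qed.

Lemma rep_iso_refl (A : comPzRingType) m n (W : qrep m n A) : rep_iso W W.
Proof. by exists (fun a => idfun); split=> // a; exists id. Qed.

(** All members of an isomorphism class classify the same point. *)
Lemma Rtilde_classified (A : comPzRingType) m n (x : Rtilde m.+1 n A) :
  {z : Zpoint m.+1 n A | forall W, sval x W -> moduli_rep W /\ classified W z}.
Proof.
apply: cid; case: x => C /= [W0 [mW0 ->]].
have [z zW0] := moduli_zpoint mW0; exists z => W [mW iW]; split=> //.
exact: classified_rep_iso zW0.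
Qed.

Lemma Rtilde_inhabited (A : comPzRingType) m n (x : Rtilde m n A) :
  exists W, sval x W.
Proof.
by case: x => C /= [W [mW ->]]; exists W; split=> //; exact: rep_iso_refl.
Qed.

Definition zpoint_of (A : comPzRingType) m n (x : Rtilde m.+1 n A) :
    Zpoint m.+1 n A :=
  sval (Rtilde_classified x).

Lemma zpoint_of_bij (A : comPzRingType) m n : (0 < n)%N ->
  bijective (@zpoint_of A m n).
Proof.
move=> hn.
have inj : injective (@zpoint_of A m n).
  move=> x y; rewrite /zpoint_of; case: Rtilde_classified => z /= zx.
  case: Rtilde_classified => z' /= zy zz'; case: _ / zz' zy => zy.
  have [[W xW] [W' yW']] := (Rtilde_inhabited x, Rtilde_inhabited y).
  have [[mW zW] [mW' zW']] := (zx _ xW, zy _ yW').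
  have [W0 [_ _ iso]] := zpoint_moduli hn z.
  apply: Rtilde_eq xW yW' _.
  exact: rep_iso_trans (rep_iso_sym (iso _ mW zW)) (iso _ mW' zW').
have surj (z : Zpoint m.+1 n A) : {x | zpoint_of x = z}.
  apply: cid; have [W0 [mW0 zW0 _]] := zpoint_moduli hn z.
  exists (exist _ (iso_class W0) (ex_intro _ W0 (conj mW0 erefl))).
  rewrite /zpoint_of; case: Rtilde_classified => z' /= /(_ W0)[].
    by split=> //; apply: rep_iso_refl.
  by move=> _ zW0'; apply: classified_uniq zW0' zW0.
exists (fun z => sval (surj z)) => [x|z]; last by case: (surj z).
by apply: inj; case: (surj _).
Qed.

Theorem theoremD (K : fieldType) (m n : nat) (hm : (1 <= m)%N) (hmn : (m <= n)%N) :
  exists eta : forall A : calg K, Rtilde m n A -> Zpoint m n A,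
    (forall A : calg K, bijective (eta A)) /\
    (forall (A B : calg K) (phi : calg_hom A B)
        (x : Rtilde m n A) (y : Rtilde m n B),
      Rtilde_base_change phi x y -> Zpoint_base_change phi (eta A x) (eta B y)).
Proof.
case: m hm hmn => [//|m] _ hmn; have hn : (0 < n)%N by apply: leq_trans hmn.
exists (fun A => @zpoint_of A m n); split=> [A|A B phi x y [W [W' [xW yW' bc]]]].
  exact: zpoint_of_bij.
rewrite /zpoint_of; case: Rtilde_classified => z /= /(_ _ xW)[mW zW].
case: Rtilde_classified => z' /= /(_ _ yW')[mW' zW'].
exact: classified_base_change bc zW zW'.
Qed.
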